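(* Suppose that: (1) $f^*$ and $\sigma^2$ are bounded; (2) either $Y$ is bounded, or $Y=f^*(X)+\sigma(X)\xi$ with $\xi$ independent of $X$ and standard normal; (3) for all $s\in[M_1]$ and $m\in[M_2]$, $\hat f_s$ and $\hat\sigma^2_{s,m}$ are bounded almost surely with respect to $\mathcal D_n$; more precisely, there exist two positive constants $K_1,K_2$ such that for all $n\in\mathbb N^*$, $\max_{s\in[M_1]}\|\hat f_s\|_\infty\le K_1$ and $\max_{(s,m)\in[M_1]\times[M_2]}\|\hat\sigma^2_{s,m}\|_\infty\le K_2$; (4) (separability) there exists $\delta_0>0$ such that $\delta^*=\min_{s\ne s^*}\{|\mathcal R(\hat f_s)-\mathcal R(\hat f_{s^*})|\}>\delta_0$. Then there exist two absolute constants $C_1>0$ and $C_2>0$ such that $$\mathbb E\left[|\hat\sigma^2_{\mathrm{MS}}(X)-\sigma^2(X)|^2\right]\le \mathbb E\left[\min_{m\in[M_2]}\mathbb E_X\left[|\hat\sigma^2_{s^*,m}(X)-\sigma^2(X)|^2\right]\right]+C_1\left\{\min_{s\in[M_1]}\mathbb E\left[\|\hat f_s-f^*\|_N^2\right]\right\}^{1/(2p)}+C_2\left(\frac{\log(M_1)}{N}\right)^{1/(4p)},$$ with $p=1$ if $Y$ is bounded and $p=2$ otherwise.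
   Context: Setting. $(X,Y)$ is a random pair in $\mathbb R^d\times\mathbb R$ with $Y=f^*(X)+W$, $\mathbb E[W\mid X]=0$, $\mathbb E[W^2]<\infty$. Thus $f^*(x)=\mathbb E[Y\mid X=x]$ is the regression function and $\sigma^2(x)=\mathrm{Var}(Y\mid X=x)=\mathbb E[(Y-f^*(X))^2\mid X=x]$ is the conditional variance function ($\sigma\ge 0$ denotes its square root). Two independent samples $\mathcal D_n=\{(X_i,Y_i)\}_{i=1}^n$ and $\mathcal D_N=\{(X_i,Y_i)\}_{i=n+1}^{n+N}$ consist of $n$ and $N$ i.i.d. copies of $(X,Y)$, respectively. $\mathbb E$ is the expectation with respect to $X$ (and $Y$ where it appears) and the samples $\mathcal D_n$ and $\mathcal D_N$; $\mathbb E_X$ is the expectation over $X$ only. Notation. For an integer $q$, $[q]=\{1,\dots,q\}$; $\|g\|_\infty=\sup_{x\in\mathbb R^d}|g(x)|$; $\|g\|_N^2=\frac1N\sum_{i=n+1}^{n+N}|g(X_i)|^2$ (average over the points of $\mathcal D_N$). Estimators. $M_1,M_2$ are integers with $2\le M_1,M_2<\infty$. $\hat f_1,\dots,\hat f_{M_1}$ are estimators of $f^*$ based on $\mathcal D_n$. For each $s\in[M_1]$, $\hat\sigma^2_{s,1},\dots,\hat\sigma^2_{s,M_2}$ are estimators of $\sigma^2$ built from $\mathcal D_n$ and $\hat f_s$ by the residual-based method (regressing the squared residuals $(Y_i-\hat f_s(X_i))^2$, $i\le n$, on the $X_i$). Model selection aggregation. Let $\hat s\in\arg\min_{s\in[M_1]}\frac1N\sum_{i=n+1}^{n+N}|Y_i-\hat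 f_s(X_i)|^2$ and $\hat f_{\mathrm{MS}}=\hat f_{\hat s}$. Put $\hat Z_i=(Y_i-\hat f_{\mathrm{MS}}(X_i))^2$, let $\hat m\in\arg\min_{m\in[M_2]}\frac1N\sum_{i=n+1}^{n+N}|\hat Z_i-\hat\sigma^2_{\hat s,m}(X_i)|^2$, and $\hat\sigma^2_{\mathrm{MS}}=\hat\sigma^2_{\hat s,\hat m}$. Oracle. $\mathcal R(\hat f_s)=\mathbb E[|Y-\hat f_s(X)|^2]$ for $s\in[M_1]$, and $s^*\in\arg\min_{s\in[M_1]}\mathcal R(\hat f_s)$.
   Formalization: The risk R(f̂_s) and oracle s* are taken conditionally on D_n, with separability required almost surely in D_n; C_1, C_2 are not absolute but depend on M_2, δ_0, K_1, K_2 and the bounds on f*, σ² and Y (not on n, N, M_1, d or the law). *)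

(* Defs.v *)
From HB Require Import structures.
From mathcomp Require Export all_boot all_order all_algebra.
From mathcomp Require Export all_classical all_reals all_analysis.

Set Implicit Arguments.
Unset Strict Implicit.
Unset Printing Implicit Defensive.

Import Order.TTheory GRing.Theory Num.Theory.
Import numFieldNormedType.Exports.

Local Open Scope classical_set_scope.
Local Open Scope ring_scope.

(* The sigma-algebra on d.-tuple R generated by the coordinates is the Borel
   sigma-algebra of R^d. *)
Notation Rvec R d := (d.-tuple R)%type.
Notation obs R d := (d.-tuple R * R)%type.
Notation sample R d n := (n.-tuple (d.-tuple R * R))%type.

Section Probability.
Context {dsp : measure_display} {T : measurableType dsp} {R : realType}.
Variable P : probability T R.

(* Product rule over the whole index set; taking A i = setT outside a subset
   gives it for every subfamily. *)
Definition mutually_independent {dU : measure_display}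
    {U : measurableType dU} (I : finType) (V : I -> T -> U) : Prop :=
  forall A : I -> set U, (forall i, measurable (A i)) ->
    P [set w | forall i, A i (V i w)] = (\prod_(i : I) P (V i @^-1` A i))%E.

Definition identically_distributed {dU : measure_display}
    {U : measurableType dU} (I : Type) (V : I -> T -> U) : Prop :=
  forall (i j : I) (A : set U), measurable A ->
    P (V i @^-1` A) = P (V j @^-1` A).

Definition independent_pair {dU dV : measure_display} {U : measurableType dU}
    {V : measurableType dV} (X : T -> U) (Z : T -> V) : Prop :=
  forall (A : set U) (B : set V), measurable A -> measurable B ->
    P (X @^-1` A `&` Z @^-1` B) = (P (X @^-1` A) * P (Z @^-1` B))%E.

(* E[V | X = x] = g x. *)
Definition is_cond_mean {dU : measure_display} {U : measurableType dU}
    (X : T -> U) (V : T -> R) (g : U -> R) : Prop :=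
  [/\ measurable_fun setT g,
      P.-integrable setT (fun w => (V w)%:E)
    & forall A : set U, measurable A ->
        (\int[P]_(w in X @^-1` A) (V w)%:E =
         \int[P]_(w in X @^-1` A) (g (X w))%:E)%E].

(* Y = f(X) + W with E[W | X] = 0 and E[W^2] < oo (part of the integrability
   of W^2), where s = sqrt(Var(Y | X = .)) >= 0. *)
Definition regression_model {dU : measure_display} {U : measurableType dU}
    (X : T -> U) (Y : T -> R) (f s : U -> R) : Prop :=
  [/\ measurable_fun setT f, measurable_fun setT s, (forall x, 0 <= s x),
      is_cond_mean X (fun w => Y w - f (X w)) (cst 0)
    & is_cond_mean X (fun w => (Y w - f (X w)) ^+ 2) (fun x => s x ^+ 2)].

Definition bounded_response (Y : T -> R) (B : R) : Prop :=
  \forall w \ae P, `|Y w| <= B.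

Definition gaussian_response {dU : measure_display} {U : measurableType dU}
    (X : T -> U) (Y : T -> R) (f s : U -> R) : Prop :=
  exists xi : {RV P >-> R},
    [/\ independent_pair X xi,
        (forall A : set R, measurable A ->
           distribution P xi A = normal_prob (0 : R) 1 A)
      & \forall w \ae P, Y w = f (X w) + s (X w) * xi w].

(* Risk of a fixed function g.  At g = fhat D, for an estimator fhat and a
   sample D independent of (X, Y), this is the expectation of
   |Y - fhat D (X)|^2 over (X, Y) given the sample. *)
Definition risk {U : Type} (X : T -> U) (Y : T -> R) (g : U -> R) : \bar R :=
  'E_P[(fun w => `|Y w - g (X w)| ^+ 2)].

Definition sq_dist {U : Type} (X : T -> U) (g h : U -> R) : \bar R :=
  'E_P[(fun w => `|g (X w) - h (X w)| ^+ 2)].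

End Probability.

Definition is_argmin {dsp : Order.disp_t} {V : porderType dsp} (I : Type)
    (F : I -> V) (i : I) : Prop :=
  forall j, (F i <= F j)%O.

(* min_(s != s0) |r s - r s0| *)
Definition separation {R : realType} (M : nat) (r : 'I_M -> \bar R)
    (s0 : 'I_M) : \bar R :=
  (\big[mine/+oo]_(s < M | s != s0) `|r s - r s0|)%E.

Section Samples.
Context {R : realType} {d : nat}.

Definition emp_risk {N : nat} (D : sample R d N) (g : Rvec R d -> R) : R :=
  N%:R^-1 * \sum_(i < N) `|(tnth D i).2 - g (tnth D i).1| ^+ 2.

Definition emp_norm_sq {N : nat} (D : sample R d N) (g : Rvec R d -> R) : R :=
  N%:R^-1 * \sum_(i < N) `|g (tnth D i).1| ^+ 2.

(* The sample (X_i, (Y_i - f(X_i))^2). *)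
Definition sq_residuals {n : nat} (D : sample R d n) (f : Rvec R d -> R) :
    sample R d n :=
  [tuple ((tnth D i).1, ((tnth D i).2 - f (tnth D i).1) ^+ 2) | i < n].

(* An estimator, or regression procedure, maps a sample to a function of x;
   it is measurable jointly in the sample and x. *)
Definition measurable_estimator {n : nat}
    (g : sample R d n -> Rvec R d -> R) : Prop :=
  measurable_fun setT (fun z : sample R d n * Rvec R d => g z.1 z.2).

Definition measurable_index {dU : measure_display} {U : measurableType dU}
    {M : nat} (s : U -> 'I_M) : Prop :=
  forall k : 'I_M, measurable (s @^-1` [set k]).

(* Residual-based variance estimator: the regression procedure A is applied
   to the squared residuals of fhat on the sample. *)
Definition residual_based {n : nat} (A fhat : sample R d n -> Rvec R d -> R)
    (D : sample R d n) : Rvec R d -> R :=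
  A (sq_residuals D (fhat D)).

End Samples.

Section DataSplit.
Context {T : Type} {R : realType} {d n N : nat}.
Variable Z : 'I_(n + N) -> T -> obs R d.

Definition first_sample (w : T) : sample R d n :=
  [tuple Z (lshift N i) w | i < n].

Definition second_sample (w : T) : sample R d N :=
  [tuple Z (rshift n i) w | i < N].

(* (X, Y) together with the n + N observations. *)
Definition all_obs (X : T -> Rvec R d) (Y : T -> R) (o : option 'I_(n + N)) :
    T -> obs R d :=
  fun w => if o is Some i then Z i w else (X w, Y w).

End DataSplit.

(* Main.v *)
Require Import Defs.
From mathcomp Require Import measurable_realfun.
From mathcomp Require Import ring lra.

(* On [shat <> sstar] some estimator whose risk exceeds that of the oracle by
   more than delta0 has an empirical risk at most that of the oracle.  The
   loss differences are affine in Y, hence have exponential moments, and a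
   union bound over M1 Chernoff bounds gives this event probability at most
   M1 exp(- c N), which is below a multiple of (log M1 / N)^e for every e in
   (0, 1/4].  On the complement the second stage is empirical risk minimization
   over the M2 candidates of the oracle, with squared residuals of conditional
   mean sigma^2 + (fhat_sstar - fstar)^2.  Compared with the candidate closest
   to sigma^2 it loses at most twice the empirical fluctuations, of order
   N^(-1/2) by a variance computation, plus 4 K2 times the squared error of
   fhat_sstar, which is at most that of every fhat_s.  These bounds are linear
   in the squared error and of order N^(-1/2), stronger than the powers in the
   statement, so p plays no role and the Gaussian case only enters through
   E exp(b |Y|) < oo. *)

(** All candidates are built from D_n, so both stages argue given D_n. No conditional expectation is
    formed for this. The pair (X, Y) and the n + N observations form one mutually independent
    family; a function that ignores one member factors through a tuple with a dummy in its slot, and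
    Tonelli replaces that member by an independent copy of (X, Y). Only nonnegative integrands are
    exchanged in this way, and a moment given D_n becomes an almost sure bound on an integral over
    (X, Y) with D_n frozen.

    The second stage reuses the observations that chose [shat], so its losses are not independent
    given the selected candidate. They are therefore written at [sstar], a function of D_n alone,
    and compared with the selected ones only where the two indices agree.

    The constants are fixed before M1, d, n, N and the law of the data, so every estimate passes
    through the bounds, delta0 and M2 only. Nothing ties M1 to N: when log M1 is large compared with
    N, the trivial bound 1 on the probability of a wrong selection takes over. *)

Set Implicit Arguments.
Unset Strict Implicit.
Unset Printing Implicit Defensive.

Import Order.TTheory GRing.Theory Num.Theory.
Import numFieldNormedType.Exports.

Local Open Scope classical_set_scope.
Local Open Scope ring_scope.

(** * Independence of one observation from all the others, and resampling *)

Section Independence.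
Context {dsp : measure_display} {T : measurableType dsp} {R : realType}.
Variable P : probability T R.

(** Rectangles are stable under intersection, which the one-coordinate cylinders that generate the
    sigma-algebra are not; uniqueness of measures needs such a generator. *)
Lemma measurable_tuple_rect (dU : measure_display) (U : measurableType dU)
    (n : nat) :
  @measurable _ (n.-tuple U) =
    <<s [set C | exists2 A : 'I_n -> set U, (forall i, measurable (A i)) &
           C = [set t | forall i, A i (tnth t i)]] >>.
Proof.
apply/seteqP; split; apply: smallest_sub; try exact: smallest_sigma_algebra.
- move=> C; rewrite -bigcup_seq => -[i _ [B mB <-]].
  apply: sub_sigma_algebra.
  exists (fun j => if j == i then B else setT).
    by move=> j; case: ifP.
  rewrite setTI; apply/seteqP; split=> [t Bt j|t /(_ i)] /=.
    by case: eqP => [->|].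
  by rewrite eqxx.
- move=> C [A mA ->].
  have -> : [set t | forall i, A i (tnth t i)] =
      \bigcap_(i in [set: 'I_n]) ((@tnth n U)^~ i @^-1` A i).
    by apply/seteqP; split=> [t At i _|t At i]; apply: At.
  apply: fin_bigcap_measurable => // i _.
  by rewrite -[X in measurable X]setTI; apply: measurable_tnth.
Qed.

(* All the variables except [V k], whose slot is filled by the dummy [u0]:
   functions of the data ignoring [V k] factor through it. *)
Definition mask {U : Type} {I : finType} (V : I -> T -> U) (k : I) (u0 : U)
    (w : T) : #|I|.-tuple U :=
  [tuple if enum_val j == k then u0 else V (enum_val j) w | j < #|I|].

Lemma measurable_mask (dU : measure_display) (U : measurableType dU)
    (I : finType) (V : I -> T -> U) (k : I) (u0 : U) :
  (forall i, measurable_fun setT (V i)) -> measurable_fun setT (mask V k u0).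
Proof.
move=> mV; apply/measurable_fun_tnthP => j.
rewrite (_ : _ \o _ =
  fun w => if enum_val j == k then u0 else V (enum_val j) w).
  by case: (enum_val j == k) => //; exact: mV.
by apply/funext => w /=; rewrite tnth_mktuple.
Qed.

(** For fixed B, both sides are finite measures in A. They agree on rectangles by the product rule,
    hence everywhere by [measure_unique]. *)
Lemma mask_independent (dU : measure_display) (U : measurableType dU)
    (I : finType) (V : I -> T -> U) (k : I) (u0 : U) :
  (forall i, measurable_fun setT (V i)) -> mutually_independent P V ->
  independent_pair P (mask V k u0) (V k).
Proof.
move=> mV indV A B mA mB.
have mk : measurable_fun setT (mask V k u0) by exact: measurable_mask.
have mVB : measurable (V k @^-1` B).
  by rewrite -[X in measurable X]setTI; apply: mV.
pose f : {mfun T >-> #|I|.-tuple U} := mfun_Sub (mem_set mk).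
pose m1 : {measure set (#|I|.-tuple U) -> \bar R} :=
  pushforward (mrestr P mVB) f.
pose c : {nonneg R} := NngNum (fine_ge0 (measure_ge0 P (V k @^-1` B))).
pose m2 : {measure set (#|I|.-tuple U) -> \bar R} :=
  mscale c (distribution P f).
have cE : (c%:num)%:E = P (V k @^-1` B).
  by rewrite /= fineK// fin_num_measure.
suff : m1 mk A = m2 A.
  rewrite /m1 /m2 /= /mrestr /mscale /distribution /pushforward/= cE.
  by rewrite muleC => <-.
apply: (measure_unique
  [set C | exists2 A : 'I_#|I| -> set U, (forall i, measurable (A i)) &
           C = [set t | forall i, A i (tnth t i)]] (fun=> setT)) => //.
- exact: measurable_tuple_rect.
- move=> _ _ [A1 mA1 ->] [A2 mA2 ->]; exists (fun i => A1 i `&` A2 i).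
    by move=> i; apply: measurableI.
  by apply/seteqP; split=> [t [h1 h2] i|t h]; [split|split=> i; case: (h i)].
- by move=> _; exists (fun=> setT) => //; apply/seteqP; split.
- by apply/seteqP; split => // t _; exists 0%N.
- move=> _ [A' mA' ->].
  suff : P (mask V k u0 @^-1` [set t | forall i, A' i (tnth t i)]
           `&` V k @^-1` B) =
         (P (V k @^-1` B) *
          P (mask V k u0 @^-1` [set t | forall i, A' i (tnth t i)]))%E.
    by rewrite /m1 /m2 /= /mscale /= cE; apply.
  (* Slot k of the mask always holds [u0]. If the k-th side of the rectangle misses it, both events
     are empty; otherwise that side imposes nothing, and the product rule applies with B or the
     whole space at k. *)
  have [u0A|u0A] := pselect (A' (enum_rank k) u0); last first.
    have -> : mask V k u0 @^-1` [set t | forall i, A' i (tnth t i)] = set0.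
      apply/seteqP; split=> // w /= /(_ (enum_rank k)).
      by rewrite tnth_mktuple enum_rankK eqxx.
    by rewrite set0I !measure0 mule0.
  pose A1 i := if i == k then B else A' (enum_rank i).
  pose A2 i := if i == k then setT else A' (enum_rank i).
  have mA1 i : measurable (A1 i) by rewrite /A1; case: ifP.
  have mA2 i : measurable (A2 i) by rewrite /A2; case: ifP.
  have -> : mask V k u0 @^-1` [set t | forall i, A' i (tnth t i)] =
            [set w | forall i, A2 i (V i w)].
    apply/seteqP; split=> [w /= h i|w /= h j].
      rewrite /A2; have := h (enum_rank i).
      by rewrite tnth_mktuple enum_rankK; case: eqP.
    rewrite tnth_mktuple; have := h (enum_val j); rewrite /A2 enum_valK.
    by case: (eqVneq (enum_val j) k) u0A => // <-; rewrite enum_valK.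
  have -> : [set w | forall i, A2 i (V i w)] `&` V k @^-1` B =
            [set w | forall i, A1 i (V i w)].
    apply/seteqP; split=> [w /= [h1 h2] i|w /= h].
      by have := h1 i; rewrite /A1 /A2; case: eqP => // ->.
    split; last by have := h k; rewrite /A1 eqxx.
    by move=> i; have := h i; rewrite /A1 /A2; case: eqP.
  rewrite !indV// (bigD1 k)//= [in RHS](bigD1 k)//=.
  have -> : A1 k = B by rewrite /A1 eqxx.
  have -> : A2 k = setT by rewrite /A2 eqxx.
  rewrite preimage_setT probability_setT mul1e; congr (_ * _)%E.
  by apply: eq_bigr => i /negbTE ik; rewrite /A1 /A2 ik.
- move=> _; rewrite /= /mrestr /pushforward.
  by rewrite (le_lt_trans (probability_le1 _ _)) ?ltry//= preimage_setT setTI.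
Qed.

Lemma measurable_integral_section (dU dV : measure_display)
    (U : measurableType dU) (V : measurableType dV) (Z : T -> V)
    (h : U * V -> \bar R) :
  measurable_fun setT Z -> measurable_fun setT h -> (forall z, 0 <= h z)%E ->
  measurable_fun setT (fun u => \int[P]_w h (u, Z w))%E.
Proof.
move=> mZ mh h0.
pose Z' : {RV P >-> V} := mfun_Sub (mem_set mZ).
have := measurable_fun_fubini_tonelli_F (m2 := distribution P Z') h mh h0.
apply: eq_measurable_fun => u _; rewrite /fubini_F.
by rewrite ge0_integral_distribution//; exact: measurableT_comp.
Qed.

(** By independence the law of the pair agrees on rectangles with the product of the two laws, hence
    equals it, and Tonelli applies to the product. Nonnegativity replaces any integrability
    condition. *)
Lemma independent_tonelli (dU dV : measure_display) (U : measurableType dU)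
    (V : measurableType dV) (X : T -> U) (Z : T -> V)
    (h : U * V -> \bar R) :
  measurable_fun setT X -> measurable_fun setT Z -> independent_pair P X Z ->
  measurable_fun setT h -> (forall z, 0 <= h z)%E ->
  (\int[P]_w h (X w, Z w) = \int[P]_w \int[P]_w' h (X w, Z w'))%E.
Proof.
move=> mX mZ iXZ mh h0.
pose X' : {RV P >-> U} := mfun_Sub (mem_set mX).
pose Z' : {RV P >-> V} := mfun_Sub (mem_set mZ).
have mXZ : measurable_fun setT (fun w => (X w, Z w)).
  exact: measurable_fun_pair.
pose W' : {RV P >-> (U * V)%type} := mfun_Sub (mem_set mXZ).
have E1 u : (\int[distribution P Z']_y h (u, y) = \int[P]_w' h (u, Z w'))%E.
  by rewrite ge0_integral_distribution//; exact: measurableT_comp.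
transitivity (\int[distribution P W']_z h z)%E.
  by rewrite ge0_integral_distribution.
transitivity (\int[(distribution P X' \x distribution P Z')%E]_z h z)%E.
  apply: eq_measure_integral => A mA _; apply/esym.
  exact: product_measure_unique.
rewrite fubini_tonelli1// /fubini_F.
under eq_integral do rewrite E1.
rewrite ge0_integral_distribution//; last by move=> u; apply: integral_ge0.
exact: measurable_integral_section.
Qed.

Lemma identically_distributed_integral (dU : measure_display)
    (U : measurableType dU) (I : Type) (V : I -> T -> U) (i j : I)
    (h : U -> \bar R) :
  (forall i, measurable_fun setT (V i)) -> identically_distributed P V ->
  measurable_fun setT h -> (forall z, 0 <= h z)%E ->
  (\int[P]_w h (V i w) = \int[P]_w h (V j w))%E.
Proof.
move=> mV idV mh h0.
pose Vi : {RV P >-> U} := mfun_Sub (mem_set (mV i)).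
pose Vj : {RV P >-> U} := mfun_Sub (mem_set (mV j)).
rewrite -[LHS](@ge0_integral_distribution _ _ _ _ _ P Vi)//.
rewrite -[RHS](@ge0_integral_distribution _ _ _ _ _ P Vj)//.
by apply: eq_measure_integral => A mA _; exact: idV.
Qed.

(** Substitute for conditioning on all observations but one: [V k] is integrated out with the rest
    frozen, and a copy [V j] may serve as integration variable. *)
Lemma integral_resample (dU : measure_display)
    (U : measurableType dU) (I : finType) (V : I -> T -> U) (k j : I)
    (u0 : U) (h : (#|I|.-tuple U) * U -> \bar R) :
  (forall i, measurable_fun setT (V i)) ->
  mutually_independent P V -> identically_distributed P V ->
  measurable_fun setT h -> (forall z, 0 <= h z)%E ->
  (\int[P]_w h (mask V k u0 w, V k w) =
   \int[P]_w \int[P]_w' h (mask V k u0 w, V j w'))%E.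
Proof.
move=> mV indV idV mh h0.
rewrite (independent_tonelli (measurable_mask k u0 mV) (mV k)
  (mask_independent k u0 mV indV) mh h0).
apply: eq_integral => w _.
apply: (identically_distributed_integral k j
  (h := fun z => h (mask V k u0 w, z))) => //.
exact: measurableT_comp.
Qed.

End Independence.

(** * Weights determined by their integrals over the fibres of a map *)

Section WeightedIntegral.
Import HBNNSimple.
Context {R : realType} {dU : measure_display} {U : measurableType dU}.

Lemma weighted_integral_nnsfun (d : measure_display) (T : measurableType d)
    (mu : {measure set T -> \bar R}) (X : T -> U) (p : T -> R)
    (g : {nnsfun U >-> R}) :
  measurable_fun setT X -> measurable_fun setT p -> (forall w, 0 <= p w) ->
  (\int[mu]_w (g (X w) * p w)%:E = \sum_(r \in range g)
     r%:E * \int[mu]_(w in X @^-1` (g @^-1` [set r])) (p w)%:E)%E.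
Proof.
move=> mX mp p0.
have mgr r : measurable (X @^-1` (g @^-1` [set r])).
  by rewrite -[X in measurable X]setTI; apply: mX.
transitivity (\int[mu]_w \sum_(r \in range g)
    (r * \1_(g @^-1` [set r]) (X w) * p w)%:E)%E.
  apply: eq_integral => w _; rewrite {1}fimfunE fsumEFin// !fsbig_finite//=.
  by rewrite mulr_suml.
rewrite ge0_integral_fsum//; first last.
- move=> r w _; rewrite lee_fin mulr_ge0//.
  by have := nnfun_muleindic_ge0 g r (X w); rewrite -EFinM lee_fin.
- move=> r; apply/measurable_EFinP; apply: measurable_funM => //.
  apply: measurable_funM => //.
  have m1 : measurable_fun setT (\1_(g @^-1` [set r]) : U -> R) by [].
  exact: measurableT_comp m1 mX.
apply: eq_fsbigr => r; rewrite inE => -[u _ <-].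
transitivity (\int[mu]_w ((g u)%:E *
    ((fun w => (p w)%:E) \_ (X @^-1` (g @^-1` [set g u]))) w))%E.
  apply: eq_integral => w _; rewrite -mulrA EFinM; congr (_ * _)%E.
  rewrite patchE indicE.
  case: ifPn => [/set_mem wr|wr]; first by rewrite mem_set ?mul1r.
  by rewrite memNset ?mul0r// => Xr; case/negP: wr; exact: mem_set.
rewrite ge0_integralZl_EFin//.
- by rewrite -integral_mkcond.
- by move=> w _; rewrite patchE; case: ifP => // _; rewrite lee_fin.
- apply/(measurable_restrictT _ _).1 => //.
  exact/measurable_funTS/measurable_EFinP.
Qed.

Lemma weighted_integral_cvg (d : measure_display) (T : measurableType d)
    (mu : {measure set T -> \bar R}) (X : T -> U) (p : T -> R)
    (k : U -> R) (mk : measurable_fun setT (EFin \o k)) :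
  measurable_fun setT X -> measurable_fun setT p -> (forall w, 0 <= p w) ->
  (forall u, 0 <= k u) ->
  (\int[mu]_w (k (X w) * p w)%:E =
   limn (fun n =>
     \int[mu]_w (nnsfun_approx measurableT mk n (X w) * p w)%:E))%E.
Proof.
move=> mX mp p0 k0; rewrite -monotone_convergence//; first last.
- move=> w _ m n mn; rewrite lee_fin ler_wpM2r//.
  exact/lefP/nd_nnsfun_approx.
- by move=> n w _; rewrite lee_fin mulr_ge0.
- move=> n; apply/measurable_EFinP; apply: measurable_funM => //.
  exact: measurableT_comp.
apply: eq_integral => w _; apply/esym/cvg_lim => //.
rewrite EFinM; under eq_fun do rewrite EFinM.
apply: cvgeZr => //.
by apply: (cvg_nnsfun_approx measurableT mk) => // u _; rewrite lee_fin.
Qed.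

(** Equality for indicators passes to simple functions and then to monotone limits. The two sides
    live on different spaces because one use passes from the law of a normal variable to its
    Lebesgue density, and another compares the positive and negative parts of a noise on one
    space. *)
Lemma weighted_integral_eq (d d' : measure_display) (T : measurableType d)
    (T' : measurableType d') (mu : {measure set T -> \bar R})
    (mu' : {measure set T' -> \bar R}) (X : T -> U) (X' : T' -> U)
    (p : T -> R) (q : T' -> R) (k : U -> R) :
  measurable_fun setT X -> measurable_fun setT p -> (forall w, 0 <= p w) ->
  measurable_fun setT X' -> measurable_fun setT q -> (forall w, 0 <= q w) ->
  measurable_fun setT k -> (forall u, 0 <= k u) ->
  (forall A, measurable A -> \int[mu]_(w in X @^-1` A) (p w)%:E =
                             \int[mu']_(w in X' @^-1` A) (q w)%:E)%E ->
  (\int[mu]_w (k (X w) * p w)%:E = \int[mu']_w (k (X' w) * q w)%:E)%E.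
Proof.
move=> mX mp p0 mX' mq q0 /measurable_EFinP mk k0 pq.
rewrite !(weighted_integral_cvg _ mk)//; congr (limn _); apply/funext => n.
rewrite !weighted_integral_nnsfun//; apply: eq_fsbigr => r _.
by rewrite pq.
Qed.

End WeightedIntegral.

(** * Moment generating function of the standard normal law *)

Section GaussianMgf.
Context {dsp : measure_display} {T : measurableType dsp} {R : realType}.
Variable P : probability T R.

(** Completing the square: exp (c x) times the density of mean 0 is exp (c^2 / 2) times the density
    of mean c, which integrates to one. *)
Lemma gaussian_mgf (xi : {RV P >-> R}) (c : R) :
  (forall A : set R, measurable A ->
     distribution P xi A = normal_prob (0 : R) 1 A) ->
  (\int[P]_w (expR (c * xi w))%:E = (expR (c ^+ 2 / 2))%:E)%E.
Proof.
move=> hxi.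
transitivity (\int[P]_w (expR (c * xi w) * cst 1 w)%:E)%E.
  by apply: eq_integral => w _; rewrite mulr1.
rewrite (weighted_integral_eq (mu' := lebesgue_measure) (X' := id)
  (X := xi) (q := normal_pdf (0 : R) 1) (k := fun x => expR (c * x)))//=.
- transitivity (\int[lebesgue_measure]_x
      ((expR (c ^+ 2 / 2))%:E * (normal_pdf c 1 x)%:E))%E.
    apply: eq_integral => x _; rewrite -EFinM; congr (_%:E).
    rewrite !normal_pdfE ?oner_eq0// /normal_fun mulrCA [RHS]mulrCA.
    congr (_ * _); rewrite -!expRD; congr expR.
    by rewrite subr0 expr1n; field.
  rewrite ge0_integralZl_EFin//.
  + by rewrite integral_normal_pdf mule1.
  + by move=> x _; rewrite lee_fin normal_pdf_ge0.
  + by apply/measurable_EFinP; exact: measurable_normal_pdf.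
- exact: measurable_normal_pdf.
- by move=> x; exact: normal_pdf_ge0.
- by apply: measurableT_comp => //; exact: measurable_funM.
- move=> A mA; rewrite integral_cst ?mul1e; last first.
    by rewrite -[X in measurable X]setTI; exact: measurable_funPT.
  exact: hxi.
Qed.

End GaussianMgf.

(** * Exponential moments of the response, and orthogonality of the noise *)

Section Moments.
Context {dsp : measure_display} {T : measurableType dsp} {R : realType}.
Variable P : probability T R.

Lemma integral_probability_cst (r : \bar R) : (\int[P]_w r = r)%E.
Proof. by rewrite integral_cst// [X in (_ * X)%E](probability_setT P) mule1. Qed.

Lemma ae_integral_le_cst (f : T -> \bar R) (C : R) :
  measurable_fun setT f -> (forall w, 0 <= f w)%E ->
  (\forall w \ae P, (f w <= C%:E)%E) -> 0 <= C -> (\int[P]_w f w <= C%:E)%E.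
Proof.
move=> mf f0 fC C0; apply: (@le_trans _ _ (\int[P]_w (cst C%:E) w)%E).
  apply: ae_ge0_le_integral => //.
  by apply: filterS fC => w.
by rewrite integral_probability_cst.
Qed.

(** One summand bounds E exp (b |Y|) for a bounded response, the other for a Gaussian one. Their sum
    serves both cases with a constant free of the law of the data. *)
Definition exp_moment_const (Bf Bsigma BY b : R) : R :=
  expR (b * `|BY|) +
  expR (b * Bf) * (2 * expR ((b * Num.sqrt Bsigma) ^+ 2 / 2)).

Lemma exp_moment_const_gt0 (Bf Bsigma BY b : R) :
  0 < exp_moment_const Bf Bsigma BY b.
Proof.
by rewrite addr_gt0 ?expR_gt0// mulr_gt0 ?expR_gt0// mulr_gt0// expR_gt0.
Qed.

(** In the Gaussian case |Y| <= Bf + sqrt Bsigma |xi|, and exp (c |x|) <= exp (c x) + exp (- c x)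
    reduces the bound to two values of [gaussian_mgf]. *)
Lemma exp_moment_le (dU : measure_display) (U : measurableType dU)
    (X : T -> U) (Y : T -> R) (f s : U -> R) (Bf Bsigma BY b : R) :
  0 <= b -> measurable_fun setT Y -> (forall x, `|f x| <= Bf) ->
  (forall x, 0 <= s x) -> (forall x, `|s x ^+ 2| <= Bsigma) ->
  bounded_response P Y BY \/ gaussian_response P X Y f s ->
  (\int[P]_w (expR (b * `|Y w|))%:E
     <= (exp_moment_const Bf Bsigma BY b)%:E)%E.
Proof.
move=> b0 mY hf s0 hs hY.
have mexp (g : T -> R) : measurable_fun setT g ->
    measurable_fun setT (fun w => (expR (b * g w))%:E).
  move=> mg; apply/measurable_EFinP; apply: measurableT_comp => //.
  exact: measurable_funM.
have mYe : measurable_fun setT (fun w => (expR (b * `|Y w|))%:E).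
  by apply: (mexp (fun w => `|Y w|)); exact: measurableT_comp.
have C0 : 0 <= expR (b * Bf) * (2 * expR ((b * Num.sqrt Bsigma) ^+ 2 / 2)).
  by rewrite mulr_ge0 ?expR_ge0// mulr_ge0// expR_ge0.
case: hY => [hB|[xi [_ xilaw hY]]].
  apply: (@le_trans _ _ (expR (b * `|BY|))%:E); last by rewrite lee_fin lerDl.
  apply: ae_integral_le_cst => //.
  apply: filterS hB => w hw; rewrite lee_fin ler_expR ler_wpM2l//.
  exact: le_trans hw (ler_norm _).
apply: (@le_trans _ _ (expR (b * Bf) *
    (2 * expR ((b * Num.sqrt Bsigma) ^+ 2 / 2)))%:E); last first.
  by rewrite lee_fin lerDr expR_ge0.
pose c := b * Num.sqrt Bsigma.
have c0 : 0 <= c by rewrite mulr_ge0// sqrtr_ge0.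
have mxi a : measurable_fun setT (fun w => (expR (a * xi w))%:E).
  apply/measurable_EFinP; apply: measurableT_comp => //.
  exact: measurable_funM.
have E a := gaussian_mgf a xilaw.
have e0 a w : (0 <= (expR (a * xi w))%:E)%E by rewrite lee_fin expR_ge0.
apply: (@le_trans _ _ (\int[P]_w ((expR (b * Bf))%:E *
    ((expR (c * xi w))%:E + (expR (- c * xi w))%:E)))%E).
  apply: ae_ge0_le_integral => //.
  - by move=> w _; rewrite mule_ge0 ?lee_fin ?expR_ge0// adde_ge0.
  - by apply: measurable_funeM; exact: emeasurable_funD.
  apply: filterS hY => w -> _.
  rewrite -EFinD -EFinM lee_fin.
  have sB : s (X w) <= Num.sqrt Bsigma.
    rewrite -(ger0_norm (s0 (X w))) -sqrtr_sqr ler_wsqrtr//.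
    exact: le_trans (ler_norm _) (hs _).
  apply: (@le_trans _ _ (expR (b * Bf) * expR (c * `|xi w|))).
    rewrite -expRD ler_expR /c -mulrA -mulrDr ler_wpM2l//.
    rewrite (le_trans (ler_normD _ _))// lerD// normrM (ger0_norm (s0 _)).
    by rewrite ler_wpM2r.
  rewrite ler_wpM2l ?expR_ge0//.
  have [x0|x0] := leP 0 (xi w).
    by rewrite ger0_norm// lerDl expR_ge0.
  by rewrite ltr0_norm// mulrN -mulNr lerDr expR_ge0.
rewrite ge0_integralZl_EFin ?expR_ge0//; last 2 first.
- by move=> w _; rewrite adde_ge0.
- exact: emeasurable_funD.
rewrite ge0_integralD// !E sqrrN -EFinD -EFinM lee_fin ler_wpM2l ?expR_ge0//.
by rewrite mulr_natl mulr2n.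
Qed.

(** An algebra containing Y and the bounded measurable functions, all of whose members are
    integrable when Y has exponential moments. Integrability of polynomials in Y with bounded
    coefficients thus follows from closure properties. *)
Definition exp_dominated (Y f : T -> R) : Prop :=
  measurable_fun setT f /\
  exists C b : R, [/\ 0 <= C, 0 <= b & forall w, `|f w| <= C * expR (b * `|Y w|)].

Lemma exp_dominated_bounded (Y f : T -> R) (K : R) :
  measurable_fun setT f -> (forall w, `|f w| <= K) -> exp_dominated Y f.
Proof.
move=> mf fK; split => //; exists `|K|, 0; split => // w.
by rewrite mul0r expR0 mulr1 (le_trans (fK w))// ler_norm.
Qed.

Lemma exp_dominated_cst (Y : T -> R) (c : R) : exp_dominated Y (fun=> c).
Proof. exact: (@exp_dominated_bounded Y _ `|c|). Qed.

Lemma exp_dominated_id (Y : T -> R) :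
  measurable_fun setT Y -> exp_dominated Y Y.
Proof.
move=> mY; split => //; exists 1, 1; split => // w.
rewrite !mul1r; apply: le_trans (expR_ge1Dx _).
by rewrite lerDr.
Qed.

Lemma exp_dominatedD (Y f g : T -> R) :
  exp_dominated Y f -> exp_dominated Y g ->
  exp_dominated Y (fun w => f w + g w).
Proof.
move=> [mf [C [b [C0 b0 fC]]]] [mg [C' [b' [C'0 b'0 gC]]]].
split; first exact: measurable_funD.
exists (C + C'), (b + b'); split; [exact: addr_ge0|exact: addr_ge0|move=> w].
rewrite (le_trans (ler_normD _ _))// mulrDl lerD//.
- rewrite (le_trans (fC w))// ler_wpM2l// ler_expR ler_wpM2r//.
  by rewrite lerDl.
- rewrite (le_trans (gC w))// ler_wpM2l// ler_expR ler_wpM2r//.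
  by rewrite lerDr.
Qed.

Lemma exp_dominatedM (Y f g : T -> R) :
  exp_dominated Y f -> exp_dominated Y g ->
  exp_dominated Y (fun w => f w * g w).
Proof.
move=> [mf [C [b [C0 b0 fC]]]] [mg [C' [b' [C'0 b'0 gC]]]].
split; first exact: measurable_funM.
exists (C * C'), (b + b'); split; [exact: mulr_ge0|exact: addr_ge0|move=> w].
by rewrite normrM mulrDl expRD mulrACA ler_pM.
Qed.

Lemma exp_dominatedN (Y f : T -> R) :
  exp_dominated Y f -> exp_dominated Y (fun w => - f w).
Proof.
move=> /(exp_dominatedM (exp_dominated_cst Y (-1))).
by under eq_fun do rewrite mulN1r.
Qed.

Lemma exp_dominatedB (Y f g : T -> R) :
  exp_dominated Y f -> exp_dominated Y g ->
  exp_dominated Y (fun w => f w - g w).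
Proof. by move=> hf hg; apply: exp_dominatedD => //; exact: exp_dominatedN. Qed.

Lemma exp_dominatedX (Y f : T -> R) (n : nat) :
  exp_dominated Y f -> exp_dominated Y (fun w => f w ^+ n).
Proof.
move=> hf; elim: n => [|n IH].
  by under eq_fun do rewrite expr0; exact: exp_dominated_cst.
by under eq_fun do rewrite exprS; exact: exp_dominatedM.
Qed.

Definition finite_exp_moments (Y : T -> R) : Prop :=
  measurable_fun setT Y /\
  forall b, 0 <= b -> (\int[P]_w (expR (b * `|Y w|))%:E < +oo)%E.

Lemma exp_dominated_integrable (Y f : T -> R) :
  finite_exp_moments Y -> exp_dominated Y f ->
  P.-integrable setT (fun w => (f w)%:E).
Proof.
move=> [mY fin] [mf [C [b [C0 b0 fC]]]].
apply/integrableP; split; first exact/measurable_EFinP.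
have me : measurable_fun setT (fun w => (expR (b * `|Y w|))%:E).
  apply/measurable_EFinP; apply: measurableT_comp => //.
  by apply: measurable_funM => //; exact: measurableT_comp.
apply: (@le_lt_trans _ _ (\int[P]_w (C%:E * (expR (b * `|Y w|))%:E))%E).
  apply: ge0_le_integral => //.
  - apply/measurable_EFinP; exact: measurableT_comp.
  - exact: measurable_funeM.
  - by move=> w _; rewrite -EFinM lee_fin.
rewrite ge0_integralZl_EFin//.
by apply: lte_mul_pinfty => //; exact: fin.
Qed.

(** The hypothesis says that the positive and negative parts of D have the same integral over each
    event of X. Taken as weights, they then give the same integral to every nonnegative function of
    X, by [weighted_integral_eq]. *)
Lemma zero_mean_on_fibres_orthogonal (dU : measure_display)
    (U : measurableType dU) (X : T -> U) (D : T -> R) (k : U -> R) (K : R) :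
  measurable_fun setT X -> P.-integrable setT (fun w => (D w)%:E) ->
  (forall A, measurable A -> \int[P]_(w in X @^-1` A) (D w)%:E = 0)%E ->
  measurable_fun setT k -> (forall u, `|k u| <= K) ->
  (\int[P]_w (k (X w) * D w) = 0)%R.
Proof.
move=> mX iD D0 mk kK.
have mD : measurable_fun setT D by apply/measurable_EFinP; case/integrableP: iD.
have mXA A : measurable A -> measurable (X @^-1` A).
  by move=> mA; rewrite -[X in measurable X]setTI; exact: mX.
have ik (h : U -> R) (L : R) : measurable_fun setT h -> (forall u, `|h u| <= L) ->
    P.-integrable setT (fun w => (h (X w) * D w)%:E).
  move=> mh hL.
  apply: (le_integrable measurableT _ _ (integrableZl measurableT L iD)).
  - apply/measurable_EFinP; apply: measurable_funM => //.
    exact: measurableT_comp.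
  - move=> w _; rewrite -EFinM /= lee_fin !normrM ler_wpM2r//.
    exact: le_trans (hL _) (ler_norm _).
have main (h : U -> R) (L : R) : measurable_fun setT h -> (forall u, `|h u| <= L) ->
    (forall u, 0 <= h u) -> (\int[P]_w (h (X w) * D w) = 0)%R.
  move=> mh hL h0.
  have E : (\int[P]_w (h (X w) * D^\+ w)%:E =
            \int[P]_w (h (X w) * D^\- w)%:E)%E.
    apply: weighted_integral_eq => //.
    - exact: measurable_funrpos.
    - exact: measurable_funrneg.
    - move=> A mA.
      have iDA : P.-integrable (X @^-1` A) (EFin \o D).
        by apply: (integrableS (E := setT)) => //; exact: mXA.
      have fp := integrable_fin_num (mXA _ mA) (integrable_funrpos (mXA _ mA) iDA).
      have fn := integrable_fin_num (mXA _ mA) (integrable_funrneg (mXA _ mA) iDA).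
      have E := integralE P (X @^-1` A) (EFin \o D).
      have E0 : (\int[P]_(w in X @^-1` A) (EFin \o D) w = 0)%E := D0 A mA.
      rewrite E0 funerpos funerneg in E.
      apply/eqP; rewrite -[eqbRHS]add0e -sube_eq//.
      by apply/eqP; exact/esym/E.
  rewrite /Rintegral integralE.
  transitivity (fine (\int[P]_w (h (X w) * D^\+ w)%:E -
                      \int[P]_w (h (X w) * D^\- w)%:E)).
    congr (fine (_ - _)%E); apply: eq_integral => w _.
    - rewrite -[(fun w => (_ * _)%:E)]/(EFin \o (fun w => h (X w) * D w)).
      by rewrite funerpos /= /funrpos maxr_pMr// mulr0.
    - rewrite -[(fun w => (_ * _)%:E)]/(EFin \o (fun w => h (X w) * D w)).
      by rewrite funerneg /= /funrneg maxr_pMr// mulr0 mulrN.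
  rewrite E subee//.
  have := ik _ _ mh hL; rewrite -[(fun w => _)]/(EFin \o (fun w => h (X w) * D w)).
  move=> /(integrable_funrneg measurableT) /(integrable_fin_num measurableT).
  rewrite (_ : EFin \o _ = fun w => (h (X w) * D^\- w)%:E)//.
  apply/funext => w /=; rewrite /funrneg maxr_pMr// mulr0 mulrN//.
(* Adding the constant K to k reduces to a nonnegative weight. *)
have K0 : 0 <= K by apply: le_trans (kK point); rewrite normr_ge0.
have iK := ik (cst K) K (measurable_cst _ ) (fun=> ltac:(by rewrite ger0_norm)).
have := main (fun u => k u + K) (K + K).
have -> : (\int[P]_w ((k (X w) + K) * D w) =
    \int[P]_w (k (X w) * D w) + \int[P]_w (K * D w))%R.
  rewrite -RintegralD//; last exact: ik mk kK.
  by apply: eq_Rintegral => w _; rewrite mulrDl.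
rewrite RintegralZl//.
have -> : (\int[P]_w D w = 0)%R.
  by rewrite /Rintegral; have := D0 setT measurableT; rewrite preimage_setT => ->.
rewrite mulr0 addr0; apply.
- exact: measurable_funD.
- by move=> u; rewrite (le_trans (ler_normD _ _))// lerD// ger0_norm.
- by move=> u; have := kK u; rewrite ler_norml => /andP[+ _];
    rewrite -subr_ge0 opprK.
Qed.

End Moments.

(** * Integrating out the second sample one observation at a time *)

Section DataSplitting.
Context {dsp : measure_display} {T : measurableType dsp} {R : realType}
  {d n N : nat}.
Variables (P : probability T R) (X : {RV P >-> Rvec R d}) (Y : {RV P >-> R})
  (Z : 'I_(n + N) -> {RV P >-> obs R d}).

Let V := all_obs (fun i => Z i : T -> obs R d) X Y.
Let Dn := first_sample (fun i => Z i : T -> obs R d).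
Let DN := second_sample (fun i => Z i : T -> obs R d).
Let XY : T -> obs R d := fun w => (X w, Y w).

Hypothesis indepV : mutually_independent P V.
Hypothesis identV : identically_distributed P V.

Lemma measurable_all_obs o : measurable_fun setT (V o).
Proof. by case: o => [i|] //=; exact: measurable_fun_pair. Qed.

Lemma measurable_first_sample : measurable_fun setT Dn.
Proof.
apply/measurable_fun_tnthP => i.
rewrite (_ : _ \o _ = Z (lshift N i))//.
by apply/funext => w /=; rewrite tnth_mktuple.
Qed.

Lemma measurable_second_sample : measurable_fun setT DN.
Proof.
apply/measurable_fun_tnthP => i.
rewrite (_ : _ \o _ = Z (rshift n i))//.
by apply/funext => w /=; rewrite tnth_mktuple.
Qed.

Let I : finType := option 'I_(n + N).
Let dn (t : #|I|.-tuple (obs R d)) : sample R d n :=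
  [tuple tnth t (enum_rank (Some (lshift N i) : I)) | i < n].
Let dN (t : #|I|.-tuple (obs R d)) : sample R d N :=
  [tuple tnth t (enum_rank (Some (rshift n i) : I)) | i < N].

Let measurable_dn : measurable_fun setT dn.
Proof.
apply/measurable_fun_tnthP => i.
rewrite (_ : _ \o _ = (@tnth _ _)^~ (enum_rank (Some (lshift N i) : I))).
  exact: measurable_tnth.
by apply/funext => w /=; rewrite tnth_mktuple.
Qed.

Let measurable_dN : measurable_fun setT dN.
Proof.
apply/measurable_fun_tnthP => i.
rewrite (_ : _ \o _ = (@tnth _ _)^~ (enum_rank (Some (rshift n i) : I))).
  exact: measurable_tnth.
by apply/funext => w /=; rewrite tnth_mktuple.
Qed.

(** The observation [o] lies outside the first sample, so masking it leaves D_n intact; it may alter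
    one slot of D_N, but F is assumed not to read that slot. For the test point no slot is altered
    and the last hypothesis is vacuous. *)
Lemma integral_fresh (o : I)
    (F : (sample R d n * sample R d N) * obs R d -> \bar R) :
  (forall i, o != Some (lshift N i)) ->
  measurable_fun setT F -> (forall z, 0 <= F z)%E ->
  (forall D D1 D2 z,
     (forall j, o != Some (rshift n j) -> tnth D1 j = tnth D2 j) ->
     F (D, D1, z) = F (D, D2, z)) ->
  (\int[P]_w F (Dn w, DN w, V o w) =
   \int[P]_w \int[P]_w' F (Dn w, DN w, XY w'))%E.
Proof.
move=> on mF F0 Fk.
pose m := mask V o point.
have dnE w : dn (m w) = Dn w.
  apply: eq_from_tnth => i; rewrite !tnth_mktuple enum_rankK.
  by rewrite eq_sym (negbTE (on i)).
have FE w z : F (dn (m w), dN (m w), z) = F (Dn w, DN w, z).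
  rewrite dnE; apply: Fk => j oj; rewrite !tnth_mktuple enum_rankK.
  by rewrite eq_sym (negbTE oj).
transitivity (\int[P]_w F (dn (m w), dN (m w), V o w))%E.
  by apply: eq_integral => w _; rewrite FE.
rewrite (@integral_resample _ _ _ P _ _ _ V o None point
  (fun z => F (dn z.1, dN z.1, z.2)))//.
- by apply: eq_integral => w _; apply: eq_integral => w' _; exact: FE.
- exact: measurable_all_obs.
- apply: (measurableT_comp mF); apply: measurable_fun_pair => //.
  by apply: measurable_fun_pair; exact: measurableT_comp.
Qed.

Lemma integral_test_point
    (F : (sample R d n * sample R d N) * obs R d -> \bar R) :
  measurable_fun setT F -> (forall z, 0 <= F z)%E ->
  (\int[P]_w F (Dn w, DN w, XY w) =
   \int[P]_w \int[P]_w' F (Dn w, DN w, XY w'))%E.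
Proof.
move=> mF F0; apply: (@integral_fresh None) => // D D1 D2 z DE.
by congr (F (_, _, _)); apply: eq_from_tnth => j; exact: DE.
Qed.

Lemma integral_second_sample_point (k : 'I_N)
    (F : (sample R d n * sample R d N) * obs R d -> \bar R) :
  measurable_fun setT F -> (forall z, 0 <= F z)%E ->
  (forall D D1 D2 z, (forall j, j != k -> tnth D1 j = tnth D2 j) ->
     F (D, D1, z) = F (D, D2, z)) ->
  (\int[P]_w F (Dn w, DN w, tnth (DN w) k) =
   \int[P]_w \int[P]_w' F (Dn w, DN w, XY w'))%E.
Proof.
move=> mF F0 Fk; rewrite -(@integral_fresh (Some (rshift n k)))//.
- by apply: eq_integral => w _; rewrite tnth_mktuple.
- by move=> i; rewrite (inj_eq Some_inj) eq_rlshift.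
- move=> D D1 D2 z DE; apply: Fk => j jk; apply: DE.
  by rewrite (inj_eq Some_inj) (inj_eq (@rshift_inj _ _)) eq_sym.
Qed.

Let measurable_XY : measurable_fun setT XY.
Proof. exact: measurable_fun_pair. Qed.

Let measurable_DnDN : measurable_fun setT (fun w => (Dn w, DN w)).
Proof.
by apply: measurable_fun_pair;
  [exact: measurable_first_sample|exact: measurable_second_sample].
Qed.

Let measurable_h (h : sample R d n * obs R d -> R) (i : 'I_N) :
  measurable_fun setT h ->
  measurable_fun setT
    (fun z : (sample R d n * sample R d N) * obs R d =>
       h (z.1.1, tnth z.1.2 i)).
Proof.
move=> mh; apply: (measurableT_comp mh); apply: measurable_fun_pair => //.
  exact: measurableT_comp.
apply: (measurableT_comp (measurable_tnth i)).
exact: measurableT_comp.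
Qed.

(** Given D_n the factors are i.i.d. with mean at most q. The last factor is integrated out against
    a fresh copy, since the product of the preceding ones does not read its slot. *)
Lemma integral_second_sample_prod (h : sample R d n * obs R d -> R) (q : R) :
  measurable_fun setT h -> (forall z, 0 <= h z) -> 0 <= q ->
  (\forall w \ae P, \int[P]_w' (h (Dn w, XY w'))%:E <= q%:E)%E ->
  (\int[P]_w (\prod_(i < N) h (Dn w, tnth (DN w) i))%:E <= (q ^+ N)%:E)%E.
Proof.
move=> mh h0 q0 hq.
have mp k : measurable_fun setT
    (fun z : (sample R d n * sample R d N) * obs R d =>
       \prod_(i < N | (i < k)%N) h (z.1.1, tnth z.1.2 i)).
  under eq_fun do rewrite big_mkcond.
  apply: measurable_prod => i _; case: (i < k)%N; last exact: measurable_cst.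
  exact: measurable_h.
have p0 k D D' : 0 <= \prod_(i < N | (i < k)%N) h (D, tnth D' i).
  by apply: prodr_ge0 => i _.
have mpw k : measurable_fun setT
    (fun w => \prod_(i < N | (i < k)%N) h (Dn w, tnth (DN w) i)).
  apply: (measurableT_comp (mp k) (g := fun w => (Dn w, DN w, XY w))).
  exact: measurable_fun_pair.
(* The samples being fixed, the induction runs over prefixes of the second sample instead of over
   N. *)
suff H k : (k <= N)%N ->
    (\int[P]_w (\prod_(i < N | (i < k)%N) h (Dn w, tnth (DN w) i))%:E
      <= (q ^+ k)%:E)%E.
  have := H N (leqnn N).
  by under eq_integral do under eq_bigl do rewrite ltn_ord.
elim: k => [_|k IH kN].
  rewrite expr0; apply: ae_integral_le_cst => //.
  - apply/measurable_EFinP; exact: (mpw 0%N).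
  - by move=> w; rewrite lee_fin.
  - by apply: aeW => w; rewrite big_pred0.
pose kk := Ordinal kN.
pose F (z : (sample R d n * sample R d N) * obs R d) : \bar R :=
  (\prod_(i < N | (i < k)%N) h (z.1.1, tnth z.1.2 i) * h (z.1.1, z.2))%:E.
have mF : measurable_fun setT F.
  apply/measurable_EFinP; apply: measurable_funM; first exact: mp.
  apply: (measurableT_comp mh); apply: measurable_fun_pair => //.
  exact: measurableT_comp.
have F0 z : (0 <= F z)%E by rewrite lee_fin mulr_ge0.
have mFw : measurable_fun setT
    (fun w => \int[P]_w' F (Dn w, DN w, XY w'))%E.
  exact: measurableT_comp (measurable_integral_section P measurable_XY mF F0)
    measurable_DnDN.
apply: (@le_trans _ _ (\int[P]_w F (Dn w, DN w, tnth (DN w) kk))%E).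
  rewrite le_eqVlt; apply/orP; left; apply/eqP; apply: eq_integral => w _.
  rewrite /F /= (bigD1 kk) /= ?ltnSn// mulrC; congr (_ * _)%:E.
  apply: eq_bigl => i; rewrite ltnS [RHS]ltn_neqAle andbC.
  by rewrite -(inj_eq val_inj).
rewrite integral_second_sample_point//; last first.
  move=> D D1 D2 z DE; congr (_ * _)%:E; apply: eq_bigr => i ik.
  by rewrite /= DE// -(inj_eq val_inj) /= ltn_eqF.
apply: (@le_trans _ _ (\int[P]_w (q%:E *
    (\prod_(i < N | (i < k)%N) h (Dn w, tnth (DN w) i))%:E))%E); last first.
  rewrite ge0_integralZl_EFin//.
  - by rewrite exprS EFinM lee_wpmul2l ?lee_fin// IH// ltnW.
  - by move=> w _; rewrite lee_fin.
  - exact/measurable_EFinP.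
apply: ae_ge0_le_integral => //.
- by move=> w _; apply: integral_ge0.
- by move=> w _; rewrite mule_ge0 ?lee_fin.
- by apply: measurable_funeM; exact/measurable_EFinP.
apply: filterS hq => w hw _; rewrite /F /=.
under eq_integral do rewrite EFinM.
rewrite ge0_integralZl_EFin//; first by rewrite muleC lee_wpmul2r ?lee_fin.
- by move=> w' _; rewrite lee_fin.
- apply/measurable_EFinP; apply: (measurableT_comp mh).
  exact: measurable_fun_pair.
Qed.

(* The shift [a] is the partial sum over the preceding points, so that only
   integrals of nonnegative functions are exchanged. *)
Lemma integral_second_sample_sum_sq (g : sample R d n * obs R d -> R) (C : R) :
  measurable_fun setT g -> 0 <= C ->
  (\forall w \ae P, forall a : R,
     \int[P]_w' ((a + g (Dn w, XY w')) ^+ 2)%:E <= (a ^+ 2 + C)%:E)%E ->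
  (\int[P]_w ((\sum_(i < N) g (Dn w, tnth (DN w) i)) ^+ 2)%:E
     <= (N%:R * C)%:E)%E.
Proof.
move=> mg C0 hg.
have ms k : measurable_fun setT
    (fun z : (sample R d n * sample R d N) * obs R d =>
       \sum_(i < N | (i < k)%N) g (z.1.1, tnth z.1.2 i)).
  under eq_fun do rewrite big_mkcond.
  apply: measurable_sum => i; case: (i < k)%N; last exact: measurable_cst.
  exact: measurable_h.
have msw k : measurable_fun setT
    (fun w => \sum_(i < N | (i < k)%N) g (Dn w, tnth (DN w) i)).
  apply: (measurableT_comp (ms k) (g := fun w => (Dn w, DN w, XY w))).
  exact: measurable_fun_pair.
suff H k : (k <= N)%N ->
    (\int[P]_w ((\sum_(i < N | (i < k)%N) g (Dn w, tnth (DN w) i)) ^+ 2)%:E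
      <= (k%:R * C)%:E)%E.
  have := H N (leqnn N).
  by under eq_integral do under eq_bigl do rewrite ltn_ord.
elim: k => [_|k IH kN].
  rewrite mul0r; apply: ae_integral_le_cst => //.
  - apply/measurable_EFinP; apply: measurable_funX; exact: (msw 0%N).
  - by move=> w; rewrite lee_fin sqr_ge0.
  - by apply: aeW => w; rewrite big_pred0// expr0n.
pose kk := Ordinal kN.
pose F (z : (sample R d n * sample R d N) * obs R d) : \bar R :=
  ((\sum_(i < N | (i < k)%N) g (z.1.1, tnth z.1.2 i) + g (z.1.1, z.2)) ^+ 2)%:E.
have mF : measurable_fun setT F.
  apply/measurable_EFinP; apply: measurable_funX; apply: measurable_funD.
    exact: ms.
  apply: (measurableT_comp mg); apply: measurable_fun_pair => //.
  exact: measurableT_comp.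
have F0 z : (0 <= F z)%E by rewrite lee_fin sqr_ge0.
have mFw : measurable_fun setT
    (fun w => \int[P]_w' F (Dn w, DN w, XY w'))%E.
  exact: measurableT_comp (measurable_integral_section P measurable_XY mF F0)
    measurable_DnDN.
apply: (@le_trans _ _ (\int[P]_w F (Dn w, DN w, tnth (DN w) kk))%E).
  rewrite le_eqVlt; apply/orP; left; apply/eqP; apply: eq_integral => w _.
  rewrite /F /= (bigD1 kk) /= ?ltnSn// addrC; congr ((_ + _) ^+ 2)%:E.
  apply: eq_bigl => i; rewrite ltnS [RHS]ltn_neqAle andbC.
  by rewrite -(inj_eq val_inj).
rewrite integral_second_sample_point//; last first.
  move=> D D1 D2 z DE; congr ((_ + _) ^+ 2)%:E; apply: eq_bigr => i ik.
  by rewrite /= DE// -(inj_eq val_inj) /= ltn_eqF.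
apply: (@le_trans _ _ (\int[P]_w
    (((\sum_(i < N | (i < k)%N) g (Dn w, tnth (DN w) i)) ^+ 2)%:E + C%:E))%E);
    last first.
  rewrite ge0_integralD//.
  - rewrite integral_probability_cst.
    rewrite -natr1 mulrDl mul1r EFinD leeD2r// IH// ltnW//.
  - by move=> w _; rewrite lee_fin sqr_ge0.
  - by apply/measurable_EFinP; exact: measurable_funX.
apply: ae_ge0_le_integral => //.
- by move=> w _; apply: integral_ge0.
- by move=> w _; rewrite -EFinD lee_fin addr_ge0// sqr_ge0.
- apply: emeasurable_funD => //.
  by apply/measurable_EFinP; exact: measurable_funX.
apply: filterS hg => w hw _; rewrite -EFinD.
exact: (hw (\sum_(i < N | (i < k)%N) g (Dn w, tnth (DN w) i))).
Qed.

(** The hypothesis for all shifts [a] states that g has mean zero and second moment at most C given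
    D_n, through integrals of nonnegative functions only. The sum then has second moment at most N
    C, and 1 + C stands where the Cauchy-Schwarz inequality would give sqrt C. *)
Lemma integral_second_sample_mean_abs (g : sample R d n * obs R d -> R)
    (C : R) :
  (0 < N)%N -> measurable_fun setT g -> 0 <= C ->
  (\forall w \ae P, forall a : R,
     \int[P]_w' ((a + g (Dn w, XY w')) ^+ 2)%:E <= (a ^+ 2 + C)%:E)%E ->
  (\int[P]_w (`|N%:R^-1 * \sum_(i < N) g (Dn w, tnth (DN w) i)|)%:E
     <= ((1 + C) / Num.sqrt N%:R)%:E)%E.
Proof.
move=> N0 mg C0 hg.
have r0 : 0 < Num.sqrt N%:R :> R by rewrite sqrtr_gt0 ltr0n.
set r := Num.sqrt N%:R in r0 *.
have ri0 : 0 <= r^-1 by rewrite invr_ge0 ltW.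
have rN : N%:R = r ^+ 2 by rewrite sqr_sqrtr// ler0n.
have msw : measurable_fun setT
    (fun w => \sum_(i < N) g (Dn w, tnth (DN w) i)).
  apply: measurable_sum => i.
  apply: (measurableT_comp (measurable_h i mg)
    (g := fun w => (Dn w, DN w, XY w))).
  exact: measurable_fun_pair.
(* |y| <= 1 + y^2 for y = x / sqrt N *)
apply: (@le_trans _ _ (\int[P]_w ((r^-1)%:E * (1%:E + (r ^- 2)%:E *
    ((\sum_(i < N) g (Dn w, tnth (DN w) i)) ^+ 2)%:E)))%E).
  apply: ge0_le_integral => //.
  - apply/measurable_EFinP; apply: measurableT_comp => //.
    exact: measurable_funM.
  - apply: measurable_funeM; apply: emeasurable_funD => //.
    apply: measurable_funeM; apply/measurable_EFinP; exact: measurable_funX.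
  - move=> w _; set x := \sum_(i < N) _.
    rewrite -[leRHS]/((r^-1 * (1 + r ^- 2 * x ^+ 2))%:E) lee_fin normrM.
    rewrite ger0_norm ?invr_ge0 ?ler0n//.
    have -> : N%:R^-1 * `|x| = r^-1 * `|r^-1 * x|.
      rewrite normrM (ger0_norm ri0).
      by rewrite mulrA rN expr2 invfM.
    have -> : r ^- 2 * x ^+ 2 = `|r^-1 * x| ^+ 2.
      by rewrite real_normK ?num_real// exprMn exprVn.
    rewrite ler_wpM2l//.
    by set y := `|_|; nra.
have sq0 w : (0 <= ((\sum_(i < N) g (Dn w, tnth (DN w) i)) ^+ 2)%:E)%E.
  by rewrite lee_fin sqr_ge0.
have msq : measurable_fun setT
    (fun w => ((\sum_(i < N) g (Dn w, tnth (DN w) i)) ^+ 2)%:E).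
  by apply/measurable_EFinP; exact: measurable_funX.
have r2 : (0 <= (r ^- 2)%:E)%E by rewrite lee_fin invr_ge0 sqr_ge0.
rewrite ge0_integralZl_EFin//; last 2 first.
- by move=> w _; rewrite adde_ge0// mule_ge0.
- by apply: emeasurable_funD => //; exact: measurable_funeM.
rewrite ge0_integralD//; last 2 first.
- by move=> w _; rewrite mule_ge0.
- exact: measurable_funeM.
rewrite integral_probability_cst.
rewrite ge0_integralZl_EFin//.
rewrite [in leRHS]mulrC EFinM lee_pmul2l ?lte_fin ?invr_gt0// EFinD leeD2l//.
apply: (@le_trans _ _ ((r ^- 2)%:E * (N%:R * C)%:E)%E).
  by rewrite lee_wpmul2l//; exact: integral_second_sample_sum_sq.
by rewrite -EFinM lee_fin rN mulrA mulVf ?mul1r// expf_neq0// gt_eqF.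
Qed.

End DataSplitting.

(** Both signs of x follow from 1 + t <= exp t at t = x and t = - x. The linear term is kept
    exactly, so that after integration it yields the gain in the Chernoff bound. *)
Lemma expR_le_quadratic (R : realType) (x : R) :
  expR x <= 1 + x + x ^+ 2 * expR `|x|.
Proof.
have e0 := expR_gt0 x.
have h : expR x - 1 <= x * expR x.
  have := expR_ge1Dx (- x); rewrite -(ler_pM2r e0) -expRD addNr expR0; lra.
have h1 := expR_ge1Dx x.
have [x0|x0] := leP 0 x.
  rewrite ger0_norm//.
  have := ler_wpM2l x0 h; rewrite expr2; nra.
have : 1 <= expR `|x| by rewrite -expR0 ler_expR.
have : 0 <= x ^+ 2 by exact: sqr_ge0.
rewrite expr2; nra.
Qed.

Lemma sqr_le_expR (R : realType) (x : R) : x ^+ 2 <= 4 * expR `|x|.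
Proof.
have := expR_ge1Dx (`|x| / 2).
have -> : expR `|x| = expR (`|x| / 2) ^+ 2.
  by rewrite -expRM_natl; congr expR; field.
rewrite -(real_normK (num_real x)).
have : 0 <= `|x| by [].
rewrite !expr2; nra.
Qed.

(** * Expectations over (X, Y) for fixed functions, the first sample being frozen *)

Section FixedFunctions.
Context {dsp : measure_display} {T : measurableType dsp} {R : realType}
  {dU : measure_display} {U : measurableType dU}.
Variables (P : probability T R) (X : T -> U) (Y : T -> R) (fstar sigma : U -> R).
Variables (M : R -> R) (Bf Bsigma : R).
Hypothesis mX : measurable_fun setT X.
Hypothesis mY : measurable_fun setT Y.
Hypothesis hM : forall b, 0 <= b ->
  (\int[P]_w (expR (b * `|Y w|))%:E <= (M b)%:E)%E.

Lemma finite_exp_moments_le : finite_exp_moments P Y.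
Proof. by split=> // b b0; rewrite (le_lt_trans (hM b0))// ltry. Qed.

Let fem := finite_exp_moments_le.
Local Notation ed := (exp_dominated Y).
Local Notation "'E[ f ]" := (\int[P]_w f w)%R (format "''E[' f ]").

Lemma Rexp_EFin (f : T -> R) : ed f -> (\int[P]_w (f w)%:E = ('E[f])%:E)%E.
Proof.
move=> hf; rewrite /Rintegral fineK//.
exact: integrable_fin_num (exp_dominated_integrable fem hf).
Qed.

Lemma RexpD (f g : T -> R) : ed f -> ed g ->
  'E[(fun w => f w + g w)] = 'E[f] + 'E[g].
Proof.
move=> hf hg.
by apply: RintegralD => //; exact: (exp_dominated_integrable fem).
Qed.

Lemma RexpB (f g : T -> R) : ed f -> ed g ->
  'E[(fun w => f w - g w)] = 'E[f] - 'E[g].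
Proof.
move=> hf hg.
by apply: RintegralB => //; exact: (exp_dominated_integrable fem).
Qed.

Lemma RexpZ (c : R) (f : T -> R) : ed f -> 'E[(fun w => c * f w)] = c * 'E[f].
Proof.
by move=> hf; apply: RintegralZl => //; exact: (exp_dominated_integrable fem).
Qed.

Lemma Rexp_cst (c : R) : 'E[(fun=> c)] = c.
Proof. by rewrite /Rintegral integral_probability_cst. Qed.

Lemma Rexp_le (f g : T -> R) : ed f -> ed g -> (forall w, f w <= g w) ->
  'E[f] <= 'E[g].
Proof.
move=> hf hg fg.
by apply: le_Rintegral => //; exact: (exp_dominated_integrable fem).
Qed.

Lemma Rexp_expR_le (b : R) : 0 <= b -> 'E[(fun w => expR (b * `|Y w|))] <= M b.
Proof.
move=> b0; rewrite -lee_fin -Rexp_EFin; first exact: hM.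
split; last first.
  by exists 1, b; split => // w; rewrite mul1r ger0_norm// expR_ge0.
apply: measurableT_comp => //; apply: measurable_funM => //.
exact: measurableT_comp.
Qed.

Lemma exp_dominated_expR (b : R) : 0 <= b -> ed (fun w => expR (b * `|Y w|)).
Proof.
move=> b0; split; last first.
  by exists 1, b; split => // w; rewrite mul1r ger0_norm// expR_ge0.
apply: measurableT_comp => //; apply: measurable_funM => //.
exact: measurableT_comp.
Qed.

Lemma exp_dominated_comp (g : U -> R) (K : R) :
  measurable_fun setT g -> (forall u, `|g u| <= K) -> ed (fun w => g (X w)).
Proof.
move=> mg gK; apply: (@exp_dominated_bounded _ _ _ Y _ K) => //.
exact: measurableT_comp.
Qed.

(* Minimizes, up to constants, 1 - l delta + 4 l^2 (exp A) (M B) over l in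
   (0, 1]; this quadratic dominates E exp(- l V) when 2|V| <= A + B |Y| and
   delta <= E V. *)
Definition chernoff_scale (A B delta : R) : R :=
  Num.min 1 (delta / (8 * (expR A * M B))).

Definition chernoff_rate (A B delta : R) : R :=
  chernoff_scale A B delta * delta / 2.

Lemma chernoff_rate_gt0 (A B delta : R) : 0 < M B -> 0 < delta ->
  0 < chernoff_rate A B delta.
Proof.
move=> MB0 d0; rewrite /chernoff_rate /chernoff_scale divr_gt0// mulr_gt0//.
by rewrite lt_min ltr01 divr_gt0// !mulr_gt0// expR_gt0.
Qed.

(** The expansion gives exp (- l V) <= 1 - l V + l^2 V^2 exp (l |V|). The factor 2 in the hypothesis
    pays for the last term: one |V| absorbs V^2 <= 4 exp |V|, the other exp (l |V|) with l <= 1, and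
    exp (2 |V|) is integrable by assumption. *)
Lemma integral_expRN_le (V : T -> R) (A B delta : R) :
  ed V -> 0 <= B -> 0 < M B -> 0 < delta ->
  (forall w, 2 * `|V w| <= A + B * `|Y w|) -> delta <= 'E[V] ->
  (\int[P]_w (expR (- (chernoff_scale A B delta * V w)))%:E
     <= (expR (- chernoff_rate A B delta))%:E)%E.
Proof.
move=> hV B0 MB0 d0 VAB dV.
set G := expR A * M B.
have G0 : 0 < G by rewrite mulr_gt0// expR_gt0.
rewrite /chernoff_rate; set l := chernoff_scale A B delta.
have l0 : 0 < l by rewrite /l /chernoff_scale lt_min ltr01 divr_gt0// mulr_gt0.
have l0' : 0 <= l := ltW l0.
have l1 : l <= 1 by rewrite /l /chernoff_scale ge_min lexx.
have lG : 8 * G * l <= delta.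
  have : l <= delta / (8 * G) by rewrite /l /chernoff_scale ge_min lexx orbT.
  have G8 : 0 < 8 * G by rewrite mulr_gt0.
  by rewrite (ler_pdivlMr _ _ G8) (mulrC l).
have mV : measurable_fun setT V by case: hV.
have hexp : ed (fun w => expR (- (l * V w))).
  split.
    apply: measurableT_comp => //; apply: measurableT_comp => //.
    exact: measurable_funM.
  exists (expR A), B; split => //.
  move=> w; rewrite ger0_norm ?expR_ge0// -expRD ler_expR.
  apply: le_trans (VAB w); rewrite (le_trans (ler_norm _))// normrN normrM.
  rewrite (gtr0_norm l0); have : 0 <= `|V w| by []; nra.
have pw w : expR (- (l * V w)) <=
    1 - l * V w + 4 * l ^+ 2 * expR A * expR (B * `|Y w|).
  apply: (le_trans (expR_le_quadratic _)); rewrite lerD2l.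
  rewrite sqrrN exprMn normrN normrM (gtr0_norm l0).
  have : expR (2 * `|V w|) <= expR A * expR (B * `|Y w|).
    by rewrite -expRD ler_expR.
  have -> : expR (2 * `|V w|) = expR `|V w| * expR `|V w|.
    by rewrite -expRD; congr expR; ring.
  have h1 := sqr_le_expR (V w).
  have h2 : expR (l * `|V w|) <= expR `|V w|.
    by rewrite ler_expR ler_piMl.
  have h3 : 0 < expR (l * `|V w|) := expR_gt0 _.
  have h4 : 0 < expR `|V w| := expR_gt0 _.
  move=> h5.
  have h6 : V w ^+ 2 * expR (l * `|V w|) <= 4 * (expR `|V w| * expR `|V w|).
    by rewrite mulrA; apply: ler_pM => //; exact: sqr_ge0.
  have h7 : V w ^+ 2 * expR (l * `|V w|) <=
      4 * (expR A * expR (B * `|Y w|)) by lra.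
  have := ler_wpM2l (sqr_ge0 l) h7; lra.
have hlin : ed (fun w => 1 - l * V w).
  apply: exp_dominatedB; first exact: exp_dominated_cst.
  by apply: exp_dominatedM => //; exact: exp_dominated_cst.
rewrite Rexp_EFin// lee_fin.
apply: (@le_trans _ _ (1 - l * delta + 4 * l ^+ 2 * G)).
  have := @Rexp_le (fun w => expR (- (l * V w))) (fun w => (1 - l * V w) +
    4 * l ^+ 2 * expR A * expR (B * `|Y w|)) hexp _ pw.
  rewrite RexpD//; last first.
    by apply: exp_dominatedM;
      [exact: exp_dominated_cst|exact: exp_dominated_expR].
  rewrite RexpB; last 2 first.
  - exact: exp_dominated_cst.
  - by apply: exp_dominatedM => //; exact: exp_dominated_cst.
  rewrite Rexp_cst RexpZ// RexpZ; last exact: exp_dominated_expR.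
  move=> h; apply: le_trans (h _) _.
    apply: exp_dominatedD => //; apply: exp_dominatedM;
      [exact: exp_dominated_cst|exact: exp_dominated_expR].
  rewrite lerD//; first by rewrite lerD2l lerN2 ler_wpM2l// ltW.
  rewrite /G -[leLHS]mulrA ler_wpM2l ?mulr_ge0//.
  by rewrite ler_wpM2l ?expR_ge0//; exact: Rexp_expR_le.
(* By [lG] the quadratic term is at most half of l delta, which leaves 1 - l delta / 2. *)
apply: le_trans (expR_ge1Dx _).
rewrite expr2; nra.
Qed.

(** Centering removes the term linear in a; what remains is a^2 plus the variance of l, at most its
    second moment. This supplies the hypothesis on shifts in the second moment bound for sums. *)
Lemma integral_centered_shift_le (l : T -> R) (C a : R) :
  ed l -> 0 <= C -> (forall w, l w ^+ 2 <= C * expR (1 * `|Y w|)) ->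
  (\int[P]_w ((a + (l w - 'E[l])) ^+ 2)%:E <= (a ^+ 2 + C * M 1)%:E)%E.
Proof.
move=> hl C0 lC.
set H := 'E[l].
pose f w := l w ^+ 2 + (2 * (a - H) * l w + (a - H) ^+ 2).
have hcl : ed (fun w => 2 * (a - H) * l w).
  by apply: exp_dominatedM => //; exact: exp_dominated_cst.
have hl2 : ed (fun w => l w ^+ 2) by exact: exp_dominatedX.
have hr : ed (fun w => 2 * (a - H) * l w + (a - H) ^+ 2).
  by apply: exp_dominatedD => //; exact: exp_dominated_cst.
have -> : (\int[P]_w ((a + (l w - H)) ^+ 2)%:E = \int[P]_w (f w)%:E)%E.
  by apply: eq_integral => w _; congr (_%:E); rewrite /f; ring.
rewrite Rexp_EFin; last exact: exp_dominatedD.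
rewrite lee_fin RexpD// RexpD//; last exact: exp_dominated_cst.
rewrite Rexp_cst RexpZ// -/H.
have : 'E[(fun w => l w ^+ 2)] <= C * M 1.
  apply: (@le_trans _ _ 'E[(fun w => C * expR (1 * `|Y w|))]).
    apply: Rexp_le => //; apply: exp_dominatedM;
      [exact: exp_dominated_cst|exact: exp_dominated_expR].
  rewrite RexpZ; last exact: exp_dominated_expR.
  by rewrite ler_wpM2l// Rexp_expR_le.
rewrite !expr2; nra.
Qed.

Hypothesis model : regression_model P X Y fstar sigma.
Hypothesis hBf : forall x, `|fstar x| <= Bf.
Hypothesis hBsigma : forall x, `|sigma x ^+ 2| <= Bsigma.

Let mfstar : measurable_fun setT fstar. Proof. by case: model. Qed.
Let msigma : measurable_fun setT sigma. Proof. by case: model. Qed.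

Let edf : ed (fun w => fstar (X w)).
Proof. exact: exp_dominated_comp hBf. Qed.

Let eds : ed (fun w => sigma (X w) ^+ 2).
Proof.
by apply: (exp_dominated_comp (g := fun x => sigma x ^+ 2)) hBsigma;
  exact: measurable_funX.
Qed.

Let edY : ed Y. Proof. exact: exp_dominated_id. Qed.

Lemma noise_orthogonal (k : U -> R) (K : R) :
  measurable_fun setT k -> (forall u, `|k u| <= K) ->
  'E[(fun w => k (X w) * (Y w - fstar (X w)))] = 0.
Proof.
move=> mk kK; case: model => _ _ _ [_ iW cW] _.
apply: (zero_mean_on_fibres_orthogonal mX iW _ mk kK) => A mA.
by rewrite cW// integral0.
Qed.

Lemma squared_noise_orthogonal (k : U -> R) (K : R) :
  measurable_fun setT k -> (forall u, `|k u| <= K) ->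
  'E[(fun w => k (X w) * ((Y w - fstar (X w)) ^+ 2 - sigma (X w) ^+ 2))] = 0.
Proof.
move=> mk kK; case: model => _ _ _ _ [_ iW cW].
have is2 := exp_dominated_integrable fem eds.
have iD : P.-integrable setT
    (fun w => ((Y w - fstar (X w)) ^+ 2 - sigma (X w) ^+ 2)%:E).
  exact: (integrableB measurableT iW is2).
apply: (zero_mean_on_fibres_orthogonal mX iD _ mk kK) => A mA.
have mXA : measurable (X @^-1` A).
  by rewrite -[X in measurable X]setTI; exact: mX.
have is2A : P.-integrable (X @^-1` A) (fun w => (sigma (X w) ^+ 2)%:E).
  exact: integrableS is2.
have iWA : P.-integrable (X @^-1` A) (fun w => ((Y w - fstar (X w)) ^+ 2)%:E).
  exact: integrableS iW.
under eq_integral do rewrite EFinB.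
rewrite (integralB mXA iWA is2A) cW// subee//.
exact: integrable_fin_num is2A.
Qed.

Lemma sq_dist_EFin (g h : U -> R) (K K' : R) :
  measurable_fun setT g -> (forall u, `|g u| <= K) ->
  measurable_fun setT h -> (forall u, `|h u| <= K') ->
  sq_dist P X g h = ('E[(fun w => (g (X w) - h (X w)) ^+ 2)])%:E.
Proof.
move=> mg gK mh hK; rewrite /sq_dist unlock -Rexp_EFin.
  by apply: eq_integral => w _; rewrite real_normK ?num_real.
apply: exp_dominatedX; apply: exp_dominatedB.
- exact: exp_dominated_comp gK.
- exact: exp_dominated_comp hK.
Qed.

Lemma exp_dominated_residual (f : U -> R) (K : R) :
  measurable_fun setT f -> (forall u, `|f u| <= K) ->
  ed (fun w => Y w - f (X w)).
Proof.
by move=> mf fK; apply: exp_dominatedB => //; exact: exp_dominated_comp fK.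
Qed.

Lemma risk_EFin (f : U -> R) (K : R) :
  measurable_fun setT f -> (forall u, `|f u| <= K) ->
  risk P X Y f = ('E[(fun w => (Y w - f (X w)) ^+ 2)])%:E.
Proof.
move=> mf fK; rewrite /risk unlock -Rexp_EFin.
  by apply: eq_integral => w _; rewrite real_normK ?num_real.
by apply: exp_dominatedX; exact: exp_dominated_residual fK.
Qed.

(** The cross term is the noise times a bounded function of X. Hence ordering estimators by risk is
    the same as ordering them by distance to [fstar]. *)
Lemma risk_decomposition (f : U -> R) (K : R) :
  measurable_fun setT f -> (forall u, `|f u| <= K) ->
  'E[(fun w => (Y w - f (X w)) ^+ 2)] =
  'E[(fun w => (Y w - fstar (X w)) ^+ 2)] +
  'E[(fun w => (f (X w) - fstar (X w)) ^+ 2)].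
Proof.
move=> mf fK.
have mk : measurable_fun setT (fun u => fstar u - f u) by exact: measurable_funB.
have kK u : `|fstar u - f u| <= Bf + K.
  by rewrite (le_trans (ler_normB _ _))// lerD.
have h1 : ed (fun w => (Y w - fstar (X w)) ^+ 2).
  by apply: exp_dominatedX; exact: exp_dominated_residual hBf.
have h2 : ed (fun w => (f (X w) - fstar (X w)) ^+ 2).
  apply: exp_dominatedX; apply: exp_dominatedB => //.
  exact: exp_dominated_comp fK.
have h3 : ed (fun w => (fstar (X w) - f (X w)) * (Y w - fstar (X w))).
  apply: exp_dominatedM; last exact: exp_dominated_residual hBf.
  by apply: exp_dominatedB => //; exact: exp_dominated_comp fK.
have h4 : ed (fun w => 2 * ((fstar (X w) - f (X w)) * (Y w - fstar (X w)))).
  by apply: exp_dominatedM => //; exact: exp_dominated_cst.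
have := noise_orthogonal mk kK => h0.
transitivity ('E[(fun w => ((Y w - fstar (X w)) ^+ 2 +
    (f (X w) - fstar (X w)) ^+ 2) +
    2 * ((fstar (X w) - f (X w)) * (Y w - fstar (X w))))]).
  by apply: eq_Rintegral => w _; ring.
rewrite RexpD//; last exact: exp_dominatedD.
by rewrite RexpD// RexpZ// h0 mulr0 addr0.
Qed.

(** With W = Y - fstar(X), the squared residual minus sigma^2 is (W^2 - sigma^2) + 2 (fstar - f) W +
    (f - fstar)^2. The first two terms are orthogonal to g1 - g2; the third enters with coefficient
    2 (g1 - g2), at most 4 K'. *)
Lemma variance_risk_difference (f g1 g2 : U -> R) (K K' : R) :
  measurable_fun setT f -> (forall u, `|f u| <= K) ->
  measurable_fun setT g1 -> (forall u, `|g1 u| <= K') ->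
  measurable_fun setT g2 -> (forall u, `|g2 u| <= K') ->
  'E[(fun w => (g1 (X w) - sigma (X w) ^+ 2) ^+ 2)] -
  'E[(fun w => (g2 (X w) - sigma (X w) ^+ 2) ^+ 2)] <=
  'E[(fun w => ((Y w - f (X w)) ^+ 2 - g1 (X w)) ^+ 2)] -
  'E[(fun w => ((Y w - f (X w)) ^+ 2 - g2 (X w)) ^+ 2)] +
  4 * K' * 'E[(fun w => (f (X w) - fstar (X w)) ^+ 2)].
Proof.
move=> mf fK mg1 g1K mg2 g2K.
have K'0 : 0 <= K' by apply: le_trans (g1K point); rewrite normr_ge0.
have K0 : 0 <= K by apply: le_trans (fK point); rewrite normr_ge0.
have edg1 : ed (fun w => g1 (X w)) by exact: exp_dominated_comp g1K.
have edg2 : ed (fun w => g2 (X w)) by exact: exp_dominated_comp g2K.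
have edff : ed (fun w => f (X w)) by exact: exp_dominated_comp fK.
have edr : ed (fun w => Y w - f (X w)) by exact: exp_dominatedB.
have edw : ed (fun w => Y w - fstar (X w)) by exact: exp_dominatedB.
pose k u := g1 u - g2 u.
have mk : measurable_fun setT k by exact: measurable_funB.
have kK u : `|k u| <= K' + K'.
  by rewrite (le_trans (ler_normB _ _))// lerD.
pose k2 u := k u * (fstar u - f u).
have mk2 : measurable_fun setT k2.
  by apply: measurable_funM => //; exact: measurable_funB.
have k2K u : `|k2 u| <= (K' + K') * (Bf + K).
  rewrite normrM ler_pM//.
  by rewrite (le_trans (ler_normB _ _))// lerD.
have h1 := squared_noise_orthogonal mk kK.
have h2 := noise_orthogonal mk2 k2K.
have edk : ed (fun w => k (X w)) by exact: exp_dominatedB.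
have edk2 : ed (fun w => k2 (X w)).
  by apply: exp_dominatedM => //; exact: exp_dominatedB.
have edb : ed (fun w => (f (X w) - fstar (X w)) ^+ 2).
  by apply: exp_dominatedX; exact: exp_dominatedB.
have d1 : ed (fun w => (g1 (X w) - sigma (X w) ^+ 2) ^+ 2).
  by apply: exp_dominatedX; exact: exp_dominatedB.
have d2 : ed (fun w => (g2 (X w) - sigma (X w) ^+ 2) ^+ 2).
  by apply: exp_dominatedX; exact: exp_dominatedB.
have d3 : ed (fun w => ((Y w - f (X w)) ^+ 2 - g1 (X w)) ^+ 2).
  by apply: exp_dominatedX; apply: exp_dominatedB => //; exact: exp_dominatedX.
have d4 : ed (fun w => ((Y w - f (X w)) ^+ 2 - g2 (X w)) ^+ 2).
  by apply: exp_dominatedX; apply: exp_dominatedB => //; exact: exp_dominatedX.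
have d5 : ed (fun w => k (X w) *
    ((Y w - fstar (X w)) ^+ 2 - sigma (X w) ^+ 2)).
  by apply: exp_dominatedM => //; apply: exp_dominatedB => //;
    exact: exp_dominatedX.
have d6 : ed (fun w => k2 (X w) * (Y w - fstar (X w))).
  exact: exp_dominatedM.
have d7 : ed (fun w => k (X w) * (f (X w) - fstar (X w)) ^+ 2).
  exact: exp_dominatedM.
have c5 : ed (fun w => 2 * (k (X w) *
    ((Y w - fstar (X w)) ^+ 2 - sigma (X w) ^+ 2))).
  by apply: exp_dominatedM => //; exact: exp_dominated_cst.
have c6 : ed (fun w => 4 * (k2 (X w) * (Y w - fstar (X w)))).
  by apply: exp_dominatedM => //; exact: exp_dominated_cst.
have c7 : ed (fun w => 2 * (k (X w) * (f (X w) - fstar (X w)) ^+ 2)).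
  by apply: exp_dominatedM => //; exact: exp_dominated_cst.
rewrite -RexpB// -RexpB//.
have -> : 'E[(fun w => (g1 (X w) - sigma (X w) ^+ 2) ^+ 2 -
                       (g2 (X w) - sigma (X w) ^+ 2) ^+ 2)] =
  'E[(fun w => ((((Y w - f (X w)) ^+ 2 - g1 (X w)) ^+ 2 -
                ((Y w - f (X w)) ^+ 2 - g2 (X w)) ^+ 2) +
     2 * (k (X w) * ((Y w - fstar (X w)) ^+ 2 - sigma (X w) ^+ 2)) +
     4 * (k2 (X w) * (Y w - fstar (X w)))) +
     2 * (k (X w) * (f (X w) - fstar (X w)) ^+ 2))].
  by apply: eq_Rintegral => w _; rewrite /k2 /k; ring.
have d34 := exp_dominatedB d3 d4.
have d345 := exp_dominatedD d34 c5.
rewrite (RexpD (exp_dominatedD d345 c6) c7) (RexpD d345 c6) (RexpD d34 c5).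
rewrite RexpZ// h1 RexpZ// h2 RexpZ// !mulr0 !addr0 lerD2l.
suff : 'E[(fun w => k (X w) * (f (X w) - fstar (X w)) ^+ 2)] <=
       'E[(fun w => (K' + K') * (f (X w) - fstar (X w)) ^+ 2)].
  rewrite RexpZ//; lra.
apply: Rexp_le => //.
  by apply: exp_dominatedM => //; exact: exp_dominated_cst.
move=> w; rewrite ler_wpM2r ?sqr_ge0//.
exact: le_trans (ler_norm _) (kK _).
Qed.

End FixedFunctions.

(** * Measurability of selected indices and of residual-based estimators *)

Section Measurability.

Lemma measurable_index_precomp (d1 d2 : measure_display)
    (U1 : measurableType d1) (U2 : measurableType d2) (M : nat)
    (s : U2 -> 'I_M) (g : U1 -> U2) :
  measurable_index s -> measurable_fun setT g -> measurable_index (s \o g).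
Proof.
move=> ms mg k; rewrite (_ : _ @^-1` _ = g @^-1` (s @^-1` [set k]))//.
by rewrite -[X in measurable X]setTI; exact: mg.
Qed.

(** The index takes finitely many values, so a preimage is a finite union over them. Measurability
    of every selected estimator reduces to this. *)
Lemma measurable_index_apply (d1 d2 : measure_display)
    (U1 : measurableType d1) (U2 : measurableType d2) (M : nat)
    (s : U1 -> 'I_M) (F : 'I_M -> U1 -> U2) :
  measurable_index s -> (forall k, measurable_fun setT (F k)) ->
  measurable_fun setT (fun u => F (s u) u).
Proof.
move=> ms mF _ B mB; rewrite setTI.
have -> : (fun u => F (s u) u) @^-1` B =
    \bigcup_(k in [set: 'I_M]) (s @^-1` [set k] `&` F k @^-1` B).
  by apply/seteqP; split=> [u Bu|u [k _ [/= -> ]]//]; exists (s u).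
apply: fin_bigcup_measurable => // k _; apply: measurableI => //.
by rewrite -[X in measurable X]setTI; exact: mF.
Qed.

Lemma measurable_big_mine (d : measure_display) (U : measurableType d)
    (R : realType) (I : Type) (s : seq I) (F : I -> U -> \bar R) :
  (forall k, measurable_fun setT (F k)) ->
  measurable_fun setT (fun u => \big[mine/+oo]_(k <- s) F k u)%E.
Proof.
move=> mF; elim: s => [|k s IH].
  by under eq_fun do rewrite big_nil; exact: measurable_cst.
by under eq_fun do rewrite big_cons; exact: measurable_mine.
Qed.

Context {R : realType} {d n : nat}.

Lemma measurable_estimator_section (g : sample R d n -> Rvec R d -> R) D :
  measurable_estimator g -> measurable_fun setT (g D).
Proof. by move=> mg; exact: measurableT_comp mg (pair1_measurable D). Qed.

Lemma measurable_sq_residuals (f : sample R d n -> Rvec R d -> R) :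
  measurable_estimator f ->
  measurable_fun setT (fun D : sample R d n => sq_residuals D (f D)).
Proof.
move=> mf; apply/measurable_fun_tnthP => i.
rewrite (_ : _ \o _ = fun D : sample R d n =>
  ((tnth D i).1, ((tnth D i).2 - f D (tnth D i).1) ^+ 2)); last first.
  by apply/funext => D /=; rewrite tnth_mktuple.
have m1 : measurable_fun setT (fun D : sample R d n => (tnth D i).1).
  by apply: measurableT_comp => //; exact: measurable_tnth.
have m2 : measurable_fun setT (fun D : sample R d n => (tnth D i).2).
  by apply: measurableT_comp => //; exact: measurable_tnth.
apply: measurable_fun_pair => //; apply: measurable_funX.
apply: measurable_funB => //.
by apply: (measurableT_comp mf (g := fun D => (D, (tnth D i).1)));
  exact: measurable_fun_pair.
Qed.

Lemma measurable_residual_based (A f : sample R d n -> Rvec R d -> R) :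
  measurable_estimator A -> measurable_estimator f ->
  measurable_estimator (residual_based A f).
Proof.
move=> mA mf.
apply: (measurableT_comp mA
  (g := fun z : sample R d n * Rvec R d => (sq_residuals z.1 (f z.1), z.2))).
apply: measurable_fun_pair => //.
exact: measurableT_comp (measurable_sq_residuals mf) _.
Qed.

End Measurability.

(** * Comparison with powers of log M1 / N *)

Section Rates.
Context {R : realType}.

Lemma ln2_gt0 : 0 < ln 2 :> R.
Proof. by rewrite ln_gt0// ltr1n. Qed.

Lemma ln2_le1 : ln 2 <= 1 :> R.
Proof.
have : ln 2 <= ln (expR 1) :> R.
  rewrite ler_ln ?posrE ?expR_gt0//.
  by have := expR_ge1Dx (1 : R); apply: le_trans; lra.
by rewrite expRK.
Qed.

Lemma ln2_le_ln (M : nat) : (2 <= M)%N -> ln 2 <= ln M%:R :> R.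
Proof.
by move=> M2; rewrite ler_ln ?posrE ?ltr0n ?ler_nat// (leq_trans _ M2).
Qed.

Lemma invn_le_rate (M N : nat) : (2 <= M)%N ->
  N%:R^-1 <= (ln 2)^-1 * (ln M%:R / N%:R) :> R.
Proof.
move=> M2; rewrite mulrA ler_peMl ?invr_ge0//.
by rewrite mulrC ler_pdivlMr ?ln2_gt0// mul1r ln2_le_ln.
Qed.

Lemma rate_gt0 (M N : nat) : (2 <= M)%N -> (1 <= N)%N ->
  0 < ln M%:R / N%:R :> R.
Proof.
move=> M2 N1; rewrite divr_gt0 ?ltr0n//.
exact: lt_le_trans ln2_gt0 (ln2_le_ln M2).
Qed.

(** Since 1 / N <= 1, lowering the exponent from 1/2 to e only increases the power. Inserting log M
    >= log 2 costs (1 / log 2)^e, at most 1 / log 2. *)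
Lemma invsqrt_le_rate (M N : nat) (e : R) : (2 <= M)%N -> (1 <= N)%N ->
  0 < e -> e <= 4^-1 ->
  (Num.sqrt N%:R)^-1 <= (ln 2)^-1 * (ln M%:R / N%:R) `^ e.
Proof.
move=> M2 N1 e0 e4.
have N0 : 0 < N%:R :> R by rewrite ltr0n.
have L0 := rate_gt0 M2 N1.
have y0 : 0 < N%:R^-1 :> R by rewrite invr_gt0.
have y1 : N%:R^-1 <= 1 :> R by rewrite invf_le1// ler1n.
have il2 : 1 <= (ln 2)^-1 :> R by rewrite invf_ge1 ?ln2_gt0// ln2_le1.
have il0 : 0 <= (ln 2)^-1 :> R by exact: le_trans il2.
rewrite -sqrtrV ?ler0n// -powR12_sqrt ?(ltW y0)//.
apply: (@le_trans _ _ (N%:R^-1 `^ e)).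
  by apply: ger_powR; rewrite ?y0 ?y1//; apply: le_trans e4 _; lra.
apply: (@le_trans _ _ (((ln 2)^-1 * (ln M%:R / N%:R)) `^ e)).
  apply: ge0_ler_powR (invn_le_rate N M2); rewrite ?nnegrE ?(ltW e0) ?(ltW y0)//.
  by rewrite mulr_ge0 ?(ltW L0).
rewrite (powRM e il0 (ltW L0)) ler_wpM2r ?powR_ge0//.
by apply: ler1_powR => //; apply: le_trans e4 _; lra.
Qed.

Definition union_bound_const (c : R) : R :=
  (Num.min 1 (c / 2))^-1 + 2 / (c * ln 2).

Lemma union_bound_const_gt0 (c : R) : 0 < c -> 0 < union_bound_const c.
Proof.
move=> c0; rewrite addr_gt0// ?invr_gt0 ?lt_min ?ltr01 ?divr_gt0//.
by rewrite mulr_gt0// ln2_gt0.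
Qed.

(** Two regimes of L = log M / N, one for each summand of the constant. If L >= k = min 1 (c / 2),
    then L^e / k >= 1. Otherwise M <= exp (c N / 2), so the union bound is at most exp (- c N / 2)
    <= 2 / (c N), which is of order L, and L <= L^e because L <= 1. *)
Lemma union_bound_le_rate (M N : nat) (c e : R) : (2 <= M)%N -> (1 <= N)%N ->
  0 < c -> 0 < e -> e <= 4^-1 ->
  Num.min 1 (M%:R * expR (- c) ^+ N) <=
    union_bound_const c * (ln M%:R / N%:R) `^ e.
Proof.
move=> M2 N1 c0 e0 e4.
have L0 := rate_gt0 M2 N1.
have N0 : 0 < N%:R :> R by rewrite ltr0n.
have e1 : e <= 1 by apply: le_trans e4 _; lra.
set L := ln M%:R / N%:R in L0 *.
have Le0 : 0 < L `^ e by exact: powR_gt0.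
rewrite /union_bound_const; set k := Num.min 1 (c / 2).
have k0 : 0 < k by rewrite lt_min ltr01 divr_gt0.
have k1 : k <= 1 by rewrite ge_min lexx.
have k2 : k <= c / 2 by rewrite ge_min lexx orbT.
have u0 : 0 < 2 / (c * ln 2) by rewrite divr_gt0// mulr_gt0// ln2_gt0.
rewrite mulrDl; have [kL|Lk] := leP k L.
  rewrite ge_min; apply/orP; left.
  apply: (@le_trans _ _ (k^-1 * L `^ e)); last first.
    by rewrite lerDl mulr_ge0 ?(ltW u0) ?(ltW Le0).
  rewrite ler_pdivlMl// mulr1; apply: (@le_trans _ _ (k `^ e)).
    by apply: ger1_powR => //; rewrite k0.
  by apply: ge0_ler_powR => //; rewrite ?nnegrE ltW.
rewrite ge_min; apply/orP; right.
apply: (@le_trans _ _ (2 / (c * ln 2) * L `^ e)); last first.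
  by rewrite lerDr mulr_ge0 ?invr_ge0 ?(ltW k0) ?(ltW Le0).
have L1 : L <= 1 by exact: le_trans (ltW Lk) k1.
apply: (@le_trans _ _ (2 / (c * ln 2) * L)); last first.
  by rewrite ler_wpM2l ?(ltW u0)//; apply: ger1_powR => //; rewrite L0.
have Mpos : 0 < M%:R :> R by rewrite ltr0n (leq_trans _ M2).
have lnM : ln M%:R <= c / 2 * N%:R.
  by rewrite -ler_pdivrMr// (le_trans (ltW Lk)).
have cN0 : 0 < c / 2 * N%:R by rewrite mulr_gt0// divr_gt0.
apply: (@le_trans _ _ (expR (- (c / 2 * N%:R)))).
  rewrite -[X in X * _](lnK Mpos) -expRM_natl -expRD ler_expR.
  have -> : N%:R * - c = - (c / 2 * N%:R) - (c / 2 * N%:R) by field.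
  by rewrite addrA; lra.
apply: (@le_trans _ _ (c / 2 * N%:R)^-1).
  rewrite expRN lef_pV2 ?posrE ?expR_gt0//.
  by apply: le_trans (expR_ge1Dx _); rewrite lerDr.
have -> : 2 / (c * ln 2) * L = 2 / c * ((ln 2)^-1 * L).
  by rewrite invfM; ring.
rewrite invfM invf_div ler_wpM2l ?invn_le_rate//.
by rewrite divr_ge0// (ltW c0).
Qed.

(** Below 1 one has x <= x^e, and above 1 one has x <= B <= B x^e. *)
Lemma bounded_le_powR (x B e : R) : 0 <= x -> x <= B -> 0 < e -> e <= 1 ->
  x <= (1 + B) * x `^ e.
Proof.
move=> x0 xB e0 e1; have B0 : 0 <= B by exact: le_trans xB.
have [->|xn0] := eqVneq x 0; first by rewrite mulr_ge0 ?powR_ge0// addr_ge0.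
have xp : 0 < x by rewrite lt_neqAle eq_sym xn0.
have pe := powR_ge0 x e.
rewrite mulrDl mul1r; have [x1|x1] := leP x 1.
  have := @ger1_powR _ x e; rewrite xp x1 => /(_ isT e1).
  by move=> h; rewrite (le_trans h)// lerDl mulr_ge0.
have : 1 <= x `^ e.
  by rewrite -(powRr0 x); apply: ler_powR; rewrite ltW.
nra.
Qed.

End Rates.

(** The left side is at most u^8 with u = |y| + K1 + K2 + 1, and u <= 8 exp (u / 8) gives u^8 <= 8^8
    exp u. *)
Lemma residual_loss_sq_le (R : realType) (y f g K1 K2 : R) :
  `|f| <= K1 -> `|g| <= K2 ->
  (((y - f) ^+ 2 - g) ^+ 2) ^+ 2 <=
    8 ^+ 8 * expR (K1 + K2 + 1) * expR (1 * `|y|).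
Proof.
move=> fK gK.
have K10 : 0 <= K1 by exact: le_trans fK.
have K20 : 0 <= K2 by exact: le_trans gK.
pose u := `|y| + (K1 + K2 + 1).
have u1 : 1 <= u by rewrite /u; have : 0 <= `|y| by []; lra.
have hu : `|(y - f) ^+ 2 - g| <= u ^+ 2.
  rewrite (le_trans (ler_normB _ _))// normrX.
  have h1 : `|y - f| <= `|y| + K1 by rewrite (le_trans (ler_normB _ _))// lerD2l.
  have : `|y - f| ^+ 2 <= (`|y| + K1) ^+ 2 by rewrite lerXn2r ?nnegrE// addr_ge0.
  rewrite /u !expr2; have : 0 <= `|y| by []; nra.
rewrite -(real_normK (num_real ((y - f) ^+ 2 - g))) -exprM.
apply: (@le_trans _ _ ((u ^+ 2) ^+ 4)).
  by rewrite lerXn2r ?nnegrE// sqr_ge0.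
have -> : 8 ^+ 8 * expR (K1 + K2 + 1) * expR (1 * `|y|) =
    (8 * expR (u / 8)) ^+ 8.
  rewrite exprMn -mulrA -expRD -expRM_natl; congr (_ * expR _).
  by rewrite /u; field.
have u8 : u <= 8 * expR (u / 8) by have := expR_ge1Dx (u / 8); lra.
have u0 : 0 <= u by exact: le_trans u1.
by rewrite -exprM lerXn2r ?nnegrE// (le_trans u0).
Qed.

(** The difference factors as (g - f) (2 y - f - g), the square of y cancelling. The leading 2 and
    the two coefficients have the form that [integral_expRN_le] expects. *)
Lemma loss_difference_le (R : realType) (y f g K : R) :
  `|f| <= K -> `|g| <= K ->
  2 * `|(y - f) ^+ 2 - (y - g) ^+ 2| <= 8 * K ^+ 2 + 8 * K * `|y|.
Proof.
move=> fK gK; have K0 : 0 <= K by exact: le_trans fK.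
have -> : (y - f) ^+ 2 - (y - g) ^+ 2 = (g - f) * (2 * y - (f + g)) by ring.
rewrite normrM.
have h1 : `|g - f| <= 2 * K.
  by rewrite (le_trans (ler_normB _ _))// mulr_natl mulr2n lerD.
have h2 : `|2 * y - (f + g)| <= 2 * `|y| + 2 * K.
  rewrite (le_trans (ler_normB _ _))// normrM (ger0_norm (x := 2))// lerD2l.
  by rewrite (le_trans (ler_normD _ _))// mulr_natl mulr2n lerD.
have := ler_pM (normr_ge0 _) (normr_ge0 _) h1 h2.
rewrite expr2; lra.
Qed.

(** * The two selection stages *)

Section ModelSelection.
Context {R : realType} {d n N M1 M2 : nat} {dsp : measure_display}
  {T : measurableType dsp}.
Variables (Bf Bsigma BY K1 K2 delta0 : R) (P : probability T R)
  (X : {RV P >-> Rvec R d}) (Y : {RV P >-> R}) (fstar sigma : Rvec R d -> R)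
  (Z : 'I_(n + N) -> {RV P >-> obs R d})
  (fhat : 'I_M1 -> sample R d n -> Rvec R d -> R)
  (proc : 'I_M1 -> 'I_M2 -> sample R d n -> Rvec R d -> R)
  (shat : sample R d n -> sample R d N -> 'I_M1)
  (mhat : sample R d n -> sample R d N -> 'I_M2)
  (sstar : sample R d n -> 'I_M1).

Let Dn := first_sample (fun i => Z i : T -> obs R d).
Let DN := second_sample (fun i => Z i : T -> obs R d).
Let sigma2 := fun x => sigma x ^+ 2.
Let sigma2hat := fun s m => residual_based (proc s m) (fhat s).
Let sigma2MS := fun D D' => sigma2hat (shat D D') (mhat D D') D.
Let XY : T -> obs R d := fun w => (X w, Y w).

Hypothesis N_gt0 : (0 < N)%N.
Hypothesis K1_gt0 : 0 < K1.
Hypothesis K2_gt0 : 0 < K2.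
Hypothesis delta0_gt0 : 0 < delta0.
Hypothesis hmodel : regression_model P X Y fstar sigma.
Hypothesis hindep : mutually_independent P
  (all_obs (fun i => Z i : T -> obs R d) X Y).
Hypothesis hident : identically_distributed P
  (all_obs (fun i => Z i : T -> obs R d) X Y).
Hypothesis hfhat : forall s, measurable_estimator (fhat s).
Hypothesis hproc : forall s m, measurable_estimator (proc s m).
Hypothesis hshat_meas : measurable_index
  (fun D : sample R d n * sample R d N => shat D.1 D.2).
Hypothesis hmhat_meas : measurable_index
  (fun D : sample R d n * sample R d N => mhat D.1 D.2).
Hypothesis hsstar_meas : measurable_index sstar.
Hypothesis hshat : forall D D',
  is_argmin (fun s => emp_risk D' (fhat s D)) (shat D D').
Hypothesis hmhat : forall D D', is_argmin
  (fun m => emp_risk (sq_residuals D' (fhat (shat D D') D))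
                     (sigma2hat (shat D D') m D)) (mhat D D').
Hypothesis hsstar :
  forall D, is_argmin (fun s => risk P X Y (fhat s D)) (sstar D).
Hypothesis hBf : forall x, `|fstar x| <= Bf.
Hypothesis hBsigma : forall x, `|sigma2 x| <= Bsigma.
Hypothesis hresp :
  bounded_response P Y BY \/ gaussian_response P X Y fstar sigma.
Hypothesis hK1 : \forall w \ae P, forall s x, `|fhat s (Dn w) x| <= K1.
Hypothesis hK2 : \forall w \ae P, forall s m x, `|sigma2hat s m (Dn w) x| <= K2.
Hypothesis hsep : \forall w \ae P,
  (delta0%:E < separation (fun s => risk P X Y (fhat s (Dn w)))
                          (sstar (Dn w)))%E.

Let M := exp_moment_const Bf Bsigma BY.

Let mX : measurable_fun setT X. Proof. by []. Qed.
Let mY : measurable_fun setT Y. Proof. by []. Qed.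
Let mfstar : measurable_fun setT fstar. Proof. by case: hmodel. Qed.
Let msigma2 : measurable_fun setT sigma2.
Proof. by apply: measurable_funX; case: hmodel. Qed.
Let mXY : measurable_fun setT XY. Proof. exact: measurable_fun_pair. Qed.
Let mDn : measurable_fun setT Dn. Proof. exact: measurable_first_sample. Qed.
Let mDN : measurable_fun setT DN. Proof. exact: measurable_second_sample. Qed.

Let hM b : 0 <= b -> (\int[P]_w (expR (b * `|Y w|))%:E <= (M b)%:E)%E.
Proof.
by move=> b0; apply: exp_moment_le hresp => //; case: hmodel.
Qed.

Let M_gt0 b : 0 < M b. Proof. exact: exp_moment_const_gt0. Qed.

Let hsigma2hat s m : measurable_estimator (sigma2hat s m).
Proof. exact: measurable_residual_based. Qed.

Let mfhat s D : measurable_fun setT (fhat s D).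
Proof. exact: measurable_estimator_section. Qed.

Let msigma2hat s m D : measurable_fun setT (sigma2hat s m D).
Proof. exact: measurable_estimator_section. Qed.

Let measurable_obs_estimator (g : sample R d n -> Rvec R d -> R) :
  measurable_estimator g ->
  measurable_fun setT (fun z : sample R d n * obs R d => g z.1 z.2.1).
Proof.
move=> mg; apply: (measurableT_comp mg (g := fun z => (z.1, z.2.1))).
by apply: measurable_fun_pair => //; exact: measurableT_comp.
Qed.

Let measurable_obs_response :
  measurable_fun setT (fun z : sample R d n * obs R d => z.2.2).
Proof. exact: measurableT_comp. Qed.

Lemma sq_distE (g h : Rvec R d -> R) :
  sq_dist P X g h = (\int[P]_w (`|g (X w) - h (X w)| ^+ 2)%:E)%E.
Proof. by rewrite /sq_dist unlock. Qed.

Lemma sq_dist_ge0 (g h : Rvec R d -> R) : (0 <= sq_dist P X g h)%E.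
Proof. by rewrite sq_distE integral_ge0// => w _; rewrite lee_fin sqr_ge0. Qed.

Lemma measurable_sq_dist (g h : sample R d n -> Rvec R d -> R) :
  measurable_estimator g -> measurable_estimator h ->
  measurable_fun setT (fun D => sq_dist P X (g D) (h D)).
Proof.
move=> mg mh; under eq_fun do rewrite sq_distE.
apply: (measurable_integral_section P mX
  (h := fun z => (`|g z.1 z.2 - h z.1 z.2| ^+ 2)%:E)).
- apply/measurable_EFinP; apply: measurable_funX; apply: measurableT_comp => //.
  exact: measurable_funB.
- by move=> z; rewrite lee_fin sqr_ge0.
Qed.

Let mcst (f : Rvec R d -> R) : measurable_fun setT f ->
  measurable_estimator (fun _ : sample R d n => f).
Proof.
by move=> mf; apply: (measurableT_comp mf (g := snd)).
Qed.

Lemma measurable_estimator_sstar (g : 'I_M1 -> sample R d n -> Rvec R d -> R) :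
  (forall s, measurable_estimator (g s)) ->
  measurable_estimator (fun D => g (sstar D) D).
Proof.
move=> mg; apply: (measurable_index_apply (s := sstar \o fst)
  (F := fun s (z : sample R d n * Rvec R d) => g s z.1 z.2)) => //.
exact: measurable_index_precomp.
Qed.

(** The first samples at which the almost sure hypotheses hold; every argument with D_n frozen is
    made for these. *)
Definition good (D : sample R d n) : Prop :=
  [/\ forall s x, `|fhat s D x| <= K1,
      forall s m x, `|sigma2hat s m D x| <= K2
    & (delta0%:E < separation (fun s => risk P X Y (fhat s D)) (sstar D))%E].

Lemma ae_good : \forall w \ae P, good (Dn w).
Proof. by apply: filterS3 hK1 hK2 hsep => w ? ? ?; split. Qed.

Let scale := chernoff_scale M (8 * K1 ^+ 2) (8 * K1) delta0.
Let rate := chernoff_rate M (8 * K1 ^+ 2) (8 * K1) delta0.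

(* The indicator of [s <> sstar] sits in every factor, so that the product over
   the sample vanishes at the oracle without a separate case. *)
Let hV (s : 'I_M1) (z : sample R d n * obs R d) : R :=
  if s == sstar z.1 then 0 else
  expR (- (scale * ((z.2.2 - fhat s z.1 z.2.1) ^+ 2 -
                    (z.2.2 - fhat (sstar z.1) z.1 z.2.1) ^+ 2))).

Let measurable_hV s : measurable_fun setT (hV s).
Proof.
apply: (measurable_index_apply (s := sstar \o fst)
  (F := fun k (z : sample R d n * obs R d) => if s == k then 0 else
  expR (- (scale * ((z.2.2 - fhat s z.1 z.2.1) ^+ 2 -
                    (z.2.2 - fhat k z.1 z.2.1) ^+ 2))))).
  exact: measurable_index_precomp.
move=> k; case: (s == k); first exact: measurable_cst.
apply: measurableT_comp => //; apply: measurableT_comp => //.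
apply: measurable_funM => //; apply: measurable_funB; apply: measurable_funX;
  by apply: measurable_funB => //; exact: measurable_obs_estimator.
Qed.

Let hV_ge0 s z : 0 <= hV s z.
Proof. by rewrite /hV; case: ifP. Qed.

Let integral_hV s D : good D ->
  (\int[P]_w (hV s (D, XY w))%:E <= (expR (- rate))%:E)%E.
Proof.
move=> [fK _ sep]; rewrite /hV /=; case: eqP => [_|/eqP ss].
  by rewrite integral0 lee_fin.
have edr k : exp_dominated Y (fun w => (Y w - fhat k D (X w)) ^+ 2).
  apply: exp_dominatedX.
  exact: (exp_dominated_residual mX mY (mfhat k D) (fK k)).
apply: (integral_expRN_le mY hM (V := fun w => (Y w - fhat s D (X w)) ^+ 2 -
    (Y w - fhat (sstar D) D (X w)) ^+ 2)) => //.
- exact: exp_dominatedB.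
- by rewrite mulr_ge0// ltW.
- by move=> w; exact: loss_difference_le.
- rewrite (RexpB mY hM)//.
  (* Separation controls only the absolute difference of the risks; its sign comes from the
     optimality of [sstar]. *)
  have h1 : (delta0%:E < `|risk P X Y (fhat s D) -
      risk P X Y (fhat (sstar D) D)|)%E.
    by apply: lt_le_trans sep _; exact: bigmin_le_cond.
  have h2 := hsstar D s.
  move: h1 h2.
  rewrite !(risk_EFin mX mY hM (mfhat _ D) (fK _)) -EFinB lte_fin => h1.
  rewrite lee_fin -subr_ge0 => h2.
  by move: h1; rewrite ger0_norm// => /ltW.
Qed.

(** Exponential Markov inequality and union bound before integration: if [shat] differs from
    [sstar], its empirical risk does not exceed that of the oracle, so its product is at least 1,
    and the other summands are nonnegative. *)
Let wrong_selection_le D D' :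
  (shat D D' != sstar D)%:R <= \sum_(s < M1) \prod_(i < N) hV s (D, tnth D' i).
Proof.
have [_|ss] := eqVneq (shat D D') (sstar D).
  by rewrite sumr_ge0// => s _; rewrite prodr_ge0.
rewrite (bigD1 (shat D D'))//= -[leLHS]addr0 lerD//; last first.
  by rewrite sumr_ge0// => s _; rewrite prodr_ge0.
rewrite /hV /= (negbTE ss) -expR_sum -expR0 ler_expR sumrN -mulr_sumr sumrB.
have scale0 : 0 <= scale.
  rewrite /scale /chernoff_scale le_min ler01 divr_ge0 ?(ltW delta0_gt0)//.
  by rewrite !mulr_ge0 ?expR_ge0 ?(ltW (M_gt0 _)).
rewrite oppr_ge0 mulr_ge0_le0// subr_le0.
have := hshat D D' (sstar D); rewrite /emp_risk ler_pM2l ?invr_gt0 ?ltr0n//.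
by under eq_bigr do rewrite real_normK ?num_real//;
   under [X in _ <= X -> _]eq_bigr do rewrite real_normK ?num_real//.
Qed.

Let measurable_wrong : measurable_fun setT
  (fun w => ((shat (Dn w) (DN w) != sstar (Dn w))%:R)%:E : \bar R).
Proof.
apply/measurable_EFinP.
have mDD : measurable_fun setT (fun w => (Dn w, DN w)).
  exact: measurable_fun_pair.
have ms1 : measurable_index (fun w => shat (Dn w) (DN w)).
  exact: (measurable_index_precomp hshat_meas mDD).
have ms2 : measurable_index (fun w => sstar (Dn w)).
  exact: (measurable_index_precomp hsstar_meas mDn).
apply: (measurable_index_apply (F := fun k w => (k != sstar (Dn w))%:R : R) ms1).
move=> k.
exact: (measurable_index_apply (F := fun k' _ => (k != k')%:R : R) ms2).
Qed.

Let measurable_hVDn s : measurable_fun setT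
  (fun w => (\prod_(i < N) hV s (Dn w, tnth (DN w) i))%:E).
Proof.
apply/measurable_EFinP; apply: measurable_prod => i _.
apply: (measurableT_comp (measurable_hV s)
  (g := fun w => (Dn w, tnth (DN w) i))).
apply: measurable_fun_pair => //.
exact: measurableT_comp (measurable_tnth i) mDN.
Qed.

Lemma wrong_selection_prob :
  (\int[P]_w ((shat (Dn w) (DN w) != sstar (Dn w))%:R)%:E
     <= (Num.min 1 (M1%:R * expR (- rate) ^+ N))%:E)%E.
Proof.
rewrite EFin_min le_min; apply/andP; split.
  apply: ae_integral_le_cst => //.
  by apply: aeW => w; rewrite lee_fin; case: (_ != _).
apply: (@le_trans _ _ (\int[P]_w (\sum_(s < M1)
    (\prod_(i < N) hV s (Dn w, tnth (DN w) i))%:E))%E).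
  apply: ge0_le_integral => //.
  - exact: emeasurable_sum.
  - by move=> w _; rewrite sumEFin lee_fin; exact: wrong_selection_le.
rewrite ge0_integral_sum//; last first.
  by move=> s w _; rewrite lee_fin prodr_ge0.
apply: (@le_trans _ _ (\sum_(s < M1) (expR (- rate) ^+ N)%:E)%E).
  apply: lee_sum => s _.
  apply: (integral_second_sample_prod hindep hident) => //.
  by apply: filterS ae_good => w; exact: integral_hV.
by rewrite sumEFin lee_fin sumr_const card_ord mulr_natl.
Qed.

(** At [sstar] the losses over the second sample are i.i.d. given D_n; at [shat] they would not
    be. *)
Let variance_loss (m : 'I_M2) (z : sample R d n * obs R d) : R :=
  ((z.2.2 - fhat (sstar z.1) z.1 z.2.1) ^+ 2 -
   sigma2hat (sstar z.1) m z.1 z.2.1) ^+ 2.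

Let variance_risk (m : 'I_M2) (D : sample R d n) : R :=
  \int[P]_w variance_loss m (D, XY w).

Let deviation (m : 'I_M2) (w : T) : R :=
  N%:R^-1 * \sum_(i < N) (variance_loss m (Dn w, tnth (DN w) i) -
                          variance_risk m (Dn w)).

Let measurable_variance_loss m : measurable_fun setT (variance_loss m).
Proof.
apply: measurable_funX; apply: measurable_funB.
  apply: measurable_funX; apply: measurable_funB => //.
  exact: (measurable_obs_estimator (measurable_estimator_sstar hfhat)).
exact: (measurable_obs_estimator (measurable_estimator_sstar
  (g := fun s => sigma2hat s m) (hsigma2hat ^~ m))).
Qed.

Let measurable_variance_risk m : measurable_fun setT (variance_risk m).
Proof.
apply: (measurableT_comp (f := @fine R)) => //.
apply: (measurable_integral_section P mXY
  (h := fun z => (variance_loss m z)%:E)).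
- exact/measurable_EFinP.
- by move=> z; rewrite lee_fin sqr_ge0.
Qed.

Let measurable_centered_loss m : measurable_fun setT
  (fun z => variance_loss m z - variance_risk m z.1).
Proof. by apply: measurable_funB => //; exact: measurableT_comp. Qed.

Let measurable_deviation m : measurable_fun setT (deviation m).
Proof.
apply: measurable_funM => //; apply: measurable_sum => i.
apply: (measurableT_comp (measurable_centered_loss m)
  (g := fun w => (Dn w, tnth (DN w) i))).
apply: measurable_fun_pair => //.
exact: measurableT_comp (measurable_tnth i) mDN.
Qed.

Let fluctuation := 8 ^+ 8 * expR (K1 + K2 + 1) * M 1.

Let deviation_le m :
  (\int[P]_w (`|deviation m w|)%:E
     <= ((1 + fluctuation) / Num.sqrt N%:R)%:E)%E.
Proof.
apply: (integral_second_sample_mean_abs hindep hident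
  (g := fun z => variance_loss m z - variance_risk m z.1)) => //.
- by rewrite !mulr_ge0 ?expR_ge0// ltW.
- apply: filterS ae_good => w [fK gK _] a.
  apply: (integral_centered_shift_le mY hM a
    (l := fun w' => variance_loss m (Dn w, XY w'))) => //.
  + rewrite /variance_loss /=; apply: exp_dominatedX; apply: exp_dominatedB.
      apply: exp_dominatedX.
      exact: (exp_dominated_residual mX mY (mfhat _ _) (fK (sstar (Dn w)))).
    exact: (exp_dominated_comp Y mX (msigma2hat _ _ _) (gK (sstar (Dn w)) m)).
  + by move=> w'; exact: residual_loss_sq_le.
Qed.

Let sq_dist_sigma2_le D s m : good D ->
  (sq_dist P X (sigma2hat s m D) sigma2 <= ((K2 + `|Bsigma|) ^+ 2)%:E)%E.
Proof.
move=> [_ gK _]; rewrite sq_distE; apply: ae_integral_le_cst => //.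
- apply/measurable_EFinP; apply: measurable_funX; apply: measurableT_comp => //.
  by apply: measurable_funB; exact: measurableT_comp.
- by apply: aeW => w; rewrite lee_fin lerXn2r ?nnegrE ?addr_ge0//
    ?(le_trans _ (gK s m (X w)))// (le_trans (ler_normB _ _))// lerD//
    (le_trans (hBsigma _))// ler_norm.
- exact: sqr_ge0.
Qed.

(** If the first stage errs, the uniform bounds on the candidates and on sigma^2 suffice. Otherwise
    the empirical optimality of [mhat] is turned into a bound on population risks, at the cost of
    the deviations at [mhat] and at the competitor, and [variance_risk_difference] passes to
    distances from sigma^2. *)
Let aggregate_le w : good (Dn w) ->
  (sq_dist P X (sigma2MS (Dn w) (DN w)) sigma2 <=
     \big[mine/+oo]_(m < M2)
        sq_dist P X (sigma2hat (sstar (Dn w)) m (Dn w)) sigma2 +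
     (((K2 + `|Bsigma|) ^+ 2)%:E *
        ((shat (Dn w) (DN w) != sstar (Dn w))%:R)%:E +
      ((4 * K2)%:E * sq_dist P X (fhat (sstar (Dn w)) (Dn w)) fstar +
       \sum_(m < M2) 2%:E * (`|deviation m w|)%:E)))%E.
Proof.
move=> gD; have [fK gK _] := gD.
set D := Dn w in gD fK gK *; set D' := DN w; set s := sstar D.
have K20 : 0 <= K2 by apply: le_trans (gK s (mhat D D') point).
have S0 : (0 <= \sum_(m < M2) 2%:E * (`|deviation m w|)%:E)%E.
  by apply: sume_ge0 => m _; rewrite mule_ge0// lee_fin.
have O0 : (0 <= \big[mine/+oo]_(m < M2)
    sq_dist P X (sigma2hat s m D) sigma2)%E.
  by apply: le_bigmin => // m _; exact: sq_dist_ge0.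
have F0 : (0 <= (4 * K2)%:E * sq_dist P X (fhat s D) fstar)%E.
  by rewrite mule_ge0 ?sq_dist_ge0// lee_fin mulr_ge0.
have [ss|ss] := eqVneq (shat D D') s; last first.
  rewrite mule1; apply: (le_trans (sq_dist_sigma2_le _ _ gD)).
  by rewrite -[leLHS]add0e leeD// -[leLHS]adde0 leeD// adde_ge0.
rewrite mule0 add0e /sigma2MS ss.
rewrite (sq_dist_EFin mX mY hM (mfhat s D) (fK s) mfstar hBf) -EFinM.
rewrite [X in (_ + (_ + X))%E](_ : _ = (\sum_(m < M2) 2 * `|deviation m w|)%:E);
  last by rewrite -sumEFin.
(* Moving the finite remainder to the left leaves a lower bound for a minimum, which is checked
   candidate by candidate. *)
rewrite -EFinD -leeBlDr//.
apply: le_bigmin; first by rewrite leey.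
move=> m _; rewrite leeBlDr//.
have sE m' := sq_dist_EFin mX mY hM (msigma2hat s m' D) (gK s m') msigma2 hBsigma.
rewrite !sE -EFinD lee_fin.
have := variance_risk_difference mX mY hM hmodel hBf hBsigma (mfhat s D) (fK s)
  (msigma2hat s (mhat D D') D) (gK s (mhat D D')) (msigma2hat s m D) (gK s m).
rewrite -[X in _ <= X - _ + _]/(variance_risk (mhat D D') D).
rewrite -[X in _ <= _ - X + _]/(variance_risk m D).
have dE m' : deviation m' w = N%:R^-1 * \sum_(i < N)
    variance_loss m' (D, tnth D' i) - variance_risk m' D.
  rewrite /deviation sumrB mulrBr sumr_const card_ord -/D.
  rewrite -[variance_risk m' D *+ N]mulr_natl.
  by rewrite mulrA mulVf ?mul1r// pnatr_eq0 -lt0n.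
have eE m' : N%:R^-1 * \sum_(i < N) variance_loss m' (D, tnth D' i) =
    emp_risk (sq_residuals D' (fhat s D)) (sigma2hat s m' D).
  congr (_ * _); apply: eq_bigr => i _.
  by rewrite [tnth (sq_residuals _ _) _]tnth_mktuple /= real_normK ?num_real.
have := hmhat D D' m; rewrite ss -!eE.
have := dE (mhat D D'); have := dE m.
(* Summing over all candidates makes the bound independent of the data-driven [mhat]; the two
   deviations to be controlled account for the factor 2, and the sum for the factor M2 in the final
   constant. *)
have h1 m' : `|deviation m' w| <= \sum_(m < M2) `|deviation m w|.
  by rewrite (bigD1 m')//= lerDl sumr_ge0.
have := h1 (mhat D D'); have := h1 m.
rewrite -mulr_sumr.
have := ler_norm (- deviation (mhat D D') w); rewrite normrN.
have := ler_norm (deviation m w).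
lra.
Qed.

Lemma aggregate_risk :
  ('E_P[(fun w => `|sigma2MS (Dn w) (DN w) (X w) - sigma2 (X w)| ^+ 2)%R] =
   \int[P]_w sq_dist P X (sigma2MS (Dn w) (DN w)) sigma2)%E.
Proof.
rewrite unlock.
pose F (z : (sample R d n * sample R d N) * obs R d) : \bar R :=
  (`|sigma2MS z.1.1 z.1.2 z.2.1 - sigma2 z.2.1| ^+ 2)%:E.
rewrite [LHS](integral_test_point hindep hident (F := F)).
- by apply: eq_integral => w _; rewrite sq_distE.
- apply/measurable_EFinP; apply: measurable_funX; apply: measurableT_comp => //.
  apply: measurable_funB; last first.
    by apply: (measurableT_comp msigma2); exact: measurableT_comp.
  have ms := measurable_index_precomp hshat_meas
    (measurable_fst : measurable_fun setT
      (@fst (sample R d n * sample R d N) (obs R d))).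
  have mm := measurable_index_precomp hmhat_meas
    (measurable_fst : measurable_fun setT
      (@fst (sample R d n * sample R d N) (obs R d))).
  apply: (measurable_index_apply (F := fun s z =>
    sigma2hat s (mhat z.1.1 z.1.2) z.1.1 z.2.1 : R) ms) => s.
  apply: (measurable_index_apply (F := fun m z =>
    sigma2hat s m z.1.1 z.2.1 : R) mm) => m.
  apply: (measurableT_comp (hsigma2hat s m) (g := fun z => (z.1.1, z.2.1))).
  by apply: measurable_fun_pair; exact: measurableT_comp.
- by move=> z; rewrite lee_fin sqr_ge0.
Qed.

Let measurable_sq_dist_Dn (g : sample R d n -> Rvec R d -> R)
    (h : Rvec R d -> R) : measurable_estimator g -> measurable_fun setT h ->
  measurable_fun setT (fun w => sq_dist P X (g (Dn w)) h).
Proof.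
move=> mg mh.
exact: measurableT_comp (measurable_sq_dist mg (mcst mh)) mDn.
Qed.

(** [fhat] uses D_n only, so each point of D_N acts as a fresh test point and all N terms have the
    same expectation. *)
Lemma expectation_emp_norm_sq s :
  ('E_P[(fun w => emp_norm_sq (DN w) (fun x => fhat s (Dn w) x - fstar x)%R)] =
   \int[P]_w sq_dist P X (fhat s (Dn w)) fstar)%E.
Proof.
pose F (z : (sample R d n * sample R d N) * obs R d) : \bar R :=
  (`|fhat s z.1.1 z.2.1 - fstar z.2.1| ^+ 2)%:E.
have mF : measurable_fun setT F.
  apply/measurable_EFinP; apply: measurable_funX; apply: measurableT_comp => //.
  apply: measurable_funB; last first.
    by apply: (measurableT_comp mfstar); exact: measurableT_comp.
  apply: (measurableT_comp (hfhat s) (g := fun z => (z.1.1, z.2.1))).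
  by apply: measurable_fun_pair; exact: measurableT_comp.
have F0 z : (0 <= F z)%E by rewrite lee_fin sqr_ge0.
have E i : (\int[P]_w F (Dn w, DN w, tnth (DN w) i) =
    \int[P]_w sq_dist P X (fhat s (Dn w)) fstar)%E.
  rewrite (integral_second_sample_point hindep hident)//.
  by apply: eq_integral => w _; rewrite sq_distE.
have mFi i : measurable_fun setT (fun w => F (Dn w, DN w, tnth (DN w) i)).
  apply: (measurableT_comp mF (g := fun w => (Dn w, DN w, tnth (DN w) i))).
  apply: measurable_fun_pair; first exact: measurable_fun_pair.
  exact: measurableT_comp (measurable_tnth i) mDN.
rewrite unlock.
transitivity (\int[P]_w ((N%:R^-1)%:E *
    \sum_(i < N) F (Dn w, DN w, tnth (DN w) i)))%E.
  by apply: eq_integral => w _; rewrite /F sumEFin -EFinM.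
rewrite ge0_integralZl_EFin//; first last.
- exact: emeasurable_sum.
- by move=> w _; apply: sume_ge0.
rewrite ge0_integral_sum//.
under eq_bigr do rewrite E -[(\int[P]_w _)%E]mul1e.
rewrite -ge0_sume_distrl// sumEFin sumr_const card_ord muleA -EFinM.
by rewrite mulVf ?mul1e// pnatr_eq0 -lt0n.
Qed.

(** The oracle varies with D_n, so it is compared with a fixed s for each good first sample, where
    least risk means least distance to [fstar]; integration and the minimum over s come
    afterwards. *)
Lemma oracle_noise_le :
  (\int[P]_w sq_dist P X (fhat (sstar (Dn w)) (Dn w)) fstar <=
   \big[mine/+oo]_(s < M1)
     'E_P[(fun w => emp_norm_sq (DN w)
                      (fun x => fhat s (Dn w) x - fstar x)%R)])%E.
Proof.
apply: le_bigmin => [|s _]; first by rewrite leey.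
rewrite expectation_emp_norm_sq; apply: ae_ge0_le_integral => //.
- by move=> w _; exact: sq_dist_ge0.
- exact: (measurable_sq_dist_Dn (measurable_estimator_sstar hfhat) mfstar).
- by move=> w _; exact: sq_dist_ge0.
- exact: (measurable_sq_dist_Dn (hfhat s) mfstar).
apply: filterS ae_good => w [fK _ _] _.
rewrite !(sq_dist_EFin mX mY hM (mfhat _ _) (fK _) mfstar hBf).
have := hsstar (Dn w) s.
rewrite !(risk_EFin mX mY hM (mfhat _ _) (fK _)) !lee_fin.
rewrite !(risk_decomposition mX mY hM hmodel hBf (mfhat _ _) (fK _)).
by rewrite lerD2l.
Qed.

(** The uniform bound under which the squared error may be replaced by a multiple of its power. *)
Lemma noise_le_cst s :
  ('E_P[(fun w => emp_norm_sq (DN w) (fun x => fhat s (Dn w) x - fstar x)%R)]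
     <= ((K1 + `|Bf|) ^+ 2)%:E)%E.
Proof.
rewrite expectation_emp_norm_sq; apply: ae_integral_le_cst.
- exact: (measurable_sq_dist_Dn (hfhat s) mfstar).
- by move=> w; exact: sq_dist_ge0.
- apply: filterS hK1 => w fK; rewrite sq_distE.
  apply: ae_integral_le_cst.
  + apply/measurable_EFinP; apply: measurable_funX.
    by apply: measurableT_comp => //; apply: measurable_funB;
      exact: measurableT_comp.
  + by move=> w'; rewrite lee_fin sqr_ge0.
  + apply: aeW => w'; rewrite lee_fin lerXn2r ?nnegrE ?addr_ge0 ?(ltW K1_gt0)//.
    rewrite (le_trans (ler_normB _ _))// lerD//.
    by rewrite (le_trans (hBf _))// ler_norm.
  + exact: sqr_ge0.
- exact: sqr_ge0.
Qed.

Let measurable_aggregate_dist :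
  measurable_fun setT (fun w => sq_dist P X (sigma2MS (Dn w) (DN w)) sigma2).
Proof.
have mDD : measurable_fun setT (fun w => (Dn w, DN w)).
  exact: measurable_fun_pair.
have ms := measurable_index_precomp hshat_meas mDD.
have mm := measurable_index_precomp hmhat_meas mDD.
apply: (measurable_index_apply (F := fun s w =>
  sq_dist P X (sigma2hat s (mhat (Dn w) (DN w)) (Dn w)) sigma2) ms) => s.
apply: (measurable_index_apply (F := fun m w =>
  sq_dist P X (sigma2hat s m (Dn w)) sigma2) mm) => m.
exact: measurable_sq_dist_Dn.
Qed.

Lemma selection_bound :
  ('E_P[(fun w => `|sigma2MS (Dn w) (DN w) (X w) - sigma2 (X w)| ^+ 2)%R] <=
     (\int[P]_w (\big[mine/+oo]_(m < M2)
        sq_dist P X (sigma2hat (sstar (Dn w)) m (Dn w)) sigma2))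
     + (4 * K2)%:E * (\big[mine/+oo]_(s < M1)
         'E_P[(fun w => emp_norm_sq (DN w)
                          (fun x => fhat s (Dn w) x - fstar x)%R)])
     + ((K2 + `|Bsigma|) ^+ 2 * Num.min 1 (M1%:R * expR (- rate) ^+ N) +
        M2%:R * (2 * ((1 + fluctuation) / Num.sqrt N%:R)))%:E)%E.
Proof.
rewrite aggregate_risk.
have K20 : 0 <= K2 by exact: ltW.
have mO : measurable_fun setT (fun w => \big[mine/+oo]_(m < M2)
    sq_dist P X (sigma2hat (sstar (Dn w)) m (Dn w)) sigma2)%E.
  apply: measurable_big_mine => m.
  exact: (measurable_sq_dist_Dn (measurable_estimator_sstar
    (g := fun s => sigma2hat s m) (hsigma2hat ^~ m)) msigma2).
have O0 w : (0 <= \big[mine/+oo]_(m < M2)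
    sq_dist P X (sigma2hat (sstar (Dn w)) m (Dn w)) sigma2)%E.
  by apply: le_bigmin => [|m _]; [rewrite leey|exact: sq_dist_ge0].
have mF : measurable_fun setT
    (fun w => sq_dist P X (fhat (sstar (Dn w)) (Dn w)) fstar).
  exact: (measurable_sq_dist_Dn (measurable_estimator_sstar hfhat) mfstar).
have F0 w : (0 <= sq_dist P X (fhat (sstar (Dn w)) (Dn w)) fstar)%E.
  exact: sq_dist_ge0.
have mS m : measurable_fun setT (fun w => (`|deviation m w|)%:E).
  by apply/measurable_EFinP; exact: measurableT_comp.
have S0 m w : (0 <= 2%:E * (`|deviation m w|)%:E)%E.
  by rewrite mule_ge0// lee_fin.
have m2S m : measurable_fun setT (fun w => 2%:E * (`|deviation m w|)%:E)%E.
  exact: measurable_funeM.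
have B0 : 0 <= (K2 + `|Bsigma|) ^+ 2 by exact: sqr_ge0.
have mSS : measurable_fun setT
    (fun w => \sum_(m < M2) 2%:E * (`|deviation m w|)%:E)%E.
  exact: emeasurable_sum.
have SS0 w : (0 <= \sum_(m < M2) 2%:E * (`|deviation m w|)%:E)%E.
  by apply: sume_ge0.
have mKF := measurable_funeM (4 * K2)%:E mF.
have KF0 w : (0 <= (4 * K2)%:E *
    sq_dist P X (fhat (sstar (Dn w)) (Dn w)) fstar)%E.
  by rewrite mule_ge0// lee_fin mulr_ge0.
have mBW := measurable_funeM ((K2 + `|Bsigma|) ^+ 2)%:E measurable_wrong.
have BW0 w : (0 <= ((K2 + `|Bsigma|) ^+ 2)%:E *
    ((shat (Dn w) (DN w) != sstar (Dn w))%:R)%:E)%E.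
  by rewrite mule_ge0// lee_fin.
have mR := emeasurable_funD mBW (emeasurable_funD mKF mSS).
have FS0 w := adde_ge0 (KF0 w) (SS0 w).
have R0 w := adde_ge0 (BW0 w) (FS0 w).
apply: (@le_trans _ _ (\int[P]_w (\big[mine/+oo]_(m < M2)
        sq_dist P X (sigma2hat (sstar (Dn w)) m (Dn w)) sigma2 +
     (((K2 + `|Bsigma|) ^+ 2)%:E *
        ((shat (Dn w) (DN w) != sstar (Dn w))%:R)%:E +
      ((4 * K2)%:E * sq_dist P X (fhat (sstar (Dn w)) (Dn w)) fstar +
       \sum_(m < M2) 2%:E * (`|deviation m w|)%:E))))%E).
  apply: ae_ge0_le_integral => //.
  - by move=> w _; exact: sq_dist_ge0.
  - by move=> w _; rewrite adde_ge0.
  - exact: emeasurable_funD.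
  - by apply: filterS ae_good => w gw _; exact: aggregate_le.
rewrite (ge0_integralD _ measurableT (fun w _ => O0 w) mO (fun w _ => R0 w) mR).
rewrite (ge0_integralD _ measurableT (fun w _ => BW0 w) mBW
  (fun w _ => FS0 w) (emeasurable_funD mKF mSS)).
rewrite (ge0_integralD _ measurableT (fun w _ => KF0 w) mKF
  (fun w _ => SS0 w) mSS).
rewrite -addeA leeD2l// addeCA (EFinD (_ * Num.min _ _)).
apply: leeD; last apply: leeD.
- rewrite ge0_integralZl_EFin//; last by rewrite mulr_ge0.
  by rewrite lee_wpmul2l ?lee_fin ?mulr_ge0//; exact: oracle_noise_le.
- rewrite ge0_integralZl_EFin// [leRHS]EFinM.
  by rewrite lee_wpmul2l ?lee_fin//; exact: wrong_selection_prob.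
- rewrite ge0_integral_sum//.
  apply: (@le_trans _ _ (\sum_(m < M2)
      (2 * ((1 + fluctuation) / Num.sqrt N%:R))%:E)%E).
    apply: lee_sum => m _; rewrite ge0_integralZl_EFin// [leRHS]EFinM.
    by rewrite lee_wpmul2l ?lee_fin//; exact: deviation_le.
  by rewrite sumEFin lee_fin sumr_const card_ord -[leLHS]mulr_natl.
Qed.

End ModelSelection.

Lemma bounded_le_poweR (R : realType) (x : \bar R) (B e : R) :
  (0 <= x)%E -> (x <= B%:E)%E -> 0 < e -> e <= 1 ->
  (x <= (1 + B)%:E * poweR x e)%E.
Proof.
case: x => [r| |]//; rewrite !lee_fin => r0 rB e0 e1.
exact: bounded_le_powR.
Qed.

Theorem theorem1 (R : realType) (Bf Bsigma BY K1 K2 delta0 : R) (M2 : nat)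
    (hK1 : 0 < K1) (hK2 : 0 < K2) (hdelta0 : 0 < delta0) (hM2 : (2 <= M2)%N) :
  exists C1 C2 : R, [/\ 0 < C1, 0 < C2 &
    forall (M1 d n N : nat) (hM1 : (2 <= M1)%N) (hn : (1 <= n)%N)
      (hN : (1 <= N)%N)
      (dsp : measure_display) (T : measurableType dsp) (P : probability T R)
      (* the pair (X, Y) and the samples D_n, D_N *)
      (X : {RV P >-> Rvec R d}) (Y : {RV P >-> R}) (fstar sigma : Rvec R d -> R)
      (Z : 'I_(n + N) -> {RV P >-> obs R d})
      (hmodel : regression_model P X Y fstar sigma)
      (hindep : mutually_independent P
         (all_obs (fun i => Z i : T -> obs R d) X Y))
      (hident : identically_distributed P
         (all_obs (fun i => Z i : T -> obs R d) X Y))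
      (* the estimators *)
      (fhat : 'I_M1 -> sample R d n -> Rvec R d -> R)
      (proc : 'I_M1 -> 'I_M2 -> sample R d n -> Rvec R d -> R)
      (hfhat : forall s, measurable_estimator (fhat s))
      (hproc : forall s m, measurable_estimator (proc s m))
      (* the selected indices and the oracle index *)
      (shat : sample R d n -> sample R d N -> 'I_M1)
      (mhat : sample R d n -> sample R d N -> 'I_M2)
      (sstar : sample R d n -> 'I_M1)
      (hshat_meas : measurable_index
         (fun D : sample R d n * sample R d N => shat D.1 D.2))
      (hmhat_meas : measurable_index
         (fun D : sample R d n * sample R d N => mhat D.1 D.2))
      (hsstar_meas : measurable_index sstar),
    let Dn := first_sample (fun i => Z i : T -> obs R d) in
    let DN := second_sample (fun i => Z i : T -> obs R d) in
    let sigma2 := fun x => sigma x ^+ 2 in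
    let sigma2hat := fun s m => residual_based (proc s m) (fhat s) in
    let sigma2MS := fun D D' => sigma2hat (shat D D') (mhat D D') D in
    let p := if `[< bounded_response P Y BY >] then 1%N else 2%N in
    (forall D D', is_argmin (fun s => emp_risk D' (fhat s D)) (shat D D')) ->
    (forall D D', is_argmin
       (fun m => emp_risk (sq_residuals D' (fhat (shat D D') D))
                          (sigma2hat (shat D D') m D))
       (mhat D D')) ->
    (forall D, is_argmin (fun s => risk P X Y (fhat s D)) (sstar D)) ->
    (* boundedness of f* and sigma^2 *)
    (forall x, `|fstar x| <= Bf) -> (forall x, `|sigma2 x| <= Bsigma) ->
    (* bounded or Gaussian response *)
    bounded_response P Y BY \/ gaussian_response P X Y fstar sigma ->
    (* bounded estimators, almost surely in D_n *)
    (\forall w \ae P, forall s x, `|fhat s (Dn w) x| <= K1) ->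
    (\forall w \ae P, forall s m x, `|sigma2hat s m (Dn w) x| <= K2) ->
    (* separability *)
    (\forall w \ae P,
       (delta0%:E < separation (fun s => risk P X Y (fhat s (Dn w)))
                               (sstar (Dn w)))%E) ->
    ('E_P[(fun w => `|sigma2MS (Dn w) (DN w) (X w) - sigma2 (X w)| ^+ 2)%R] <=
       (\int[P]_w (\big[mine/+oo]_(m < M2)
          sq_dist P X (sigma2hat (sstar (Dn w)) m (Dn w)) sigma2))
       + C1%:E * poweR (\big[mine/+oo]_(s < M1)
           'E_P[(fun w => emp_norm_sq (DN w)
                            (fun x => fhat s (Dn w) x - fstar x)%R)])
           ((2 * p)%:R^-1)%R
       + (C2 * powR (ln M1%:R / N%:R) ((4 * p)%:R^-1))%R%:E)%E].
Proof.
pose M := exp_moment_const Bf Bsigma BY.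
pose rate := chernoff_rate M (8 * K1 ^+ 2) (8 * K1) delta0.
pose fluct := 8 ^+ 8 * expR (K1 + K2 + 1) * M 1.
pose B1 := (K1 + `|Bf|) ^+ 2.
pose B2 := (K2 + `|Bsigma|) ^+ 2.
have M0 b : 0 < M b by exact: exp_moment_const_gt0.
have rate0 : 0 < rate by exact: chernoff_rate_gt0.
have fluct0 : 0 <= fluct by rewrite /fluct !mulr_ge0 ?expR_ge0 ?(ltW (M0 _)).
have B10 : 0 <= B1 by exact: sqr_ge0.
have B20 : 0 < B2 by rewrite /B2 exprn_gt0// ltr_pwDl.
have ln20 : 0 < ln 2 :> R by exact: ln2_gt0.
have ubc0 := union_bound_const_gt0 rate0.
(* The first constant is the cost 4 K2 of the bias times the price 1 + B1 of passing to a power. The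
   second adds the wrong selection, weighted by the worst loss B2, and the fluctuations of the M2
   candidates. *)
exists (4 * K2 * (1 + B1)),
  (B2 * union_bound_const rate + M2%:R * (2 * (1 + fluct)) * (ln 2)^-1).
split; first by rewrite !mulr_gt0// ltr_pwDl.
  have h0 : 0 <= M2%:R * (2 * (1 + fluct)) * (ln 2)^-1.
    by rewrite !mulr_ge0 ?invr_ge0 ?(ltW ln20)// addr_ge0.
  by rewrite ltr_pwDl// mulr_gt0.
move=> M1 d n N hM1 hn hN dsp T P X Y fstar sigma Z hmodel hindep hident
  fhat proc hfhat hproc shat mhat sstar hshat_meas hmhat_meas hsstar_meas
  Dn DN sigma2 sigma2hat sigma2MS p hshat hmhat hsstar hBf hBsigma hresp
  hb1 hb2 hsep.
have p12 : (p == 1%N) || (p == 2%N) by rewrite /p; case: ifP.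
have e1 : 0 < ((2 * p)%:R^-1 : R) <= 1.
  by case/orP: p12 => /eqP ->; apply/andP; split; rewrite /=; lra.
have e2 : 0 < ((4 * p)%:R^-1 : R) <= 4^-1.
  by case/orP: p12 => /eqP ->; apply/andP; split; rewrite /=; lra.
case/andP: e1 => e10 e11; case/andP: e2 => e20 e21.
apply: (le_trans (selection_bound hN hK1 hK2 hdelta0 hmodel hindep hident hfhat
  hproc hshat_meas hmhat_meas hsstar_meas hshat hmhat hsstar hBf hBsigma hresp
  hb1 hb2 hsep)).
apply: leeD; first apply: leeD2l.
- rewrite (EFinM (4 * K2)) -muleA lee_wpmul2l ?lee_fin ?mulr_ge0 ?(ltW hK2)//.
  apply: bounded_le_poweR => //.
  + apply: le_bigmin => [|s _]; first by rewrite leey.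
    apply: expectation_ge0 => w; rewrite /emp_norm_sq mulr_ge0 ?invr_ge0//.
    by rewrite sumr_ge0.
  (* Any single index bounds the minimum; index 0 exists because M1 is positive. *)
  + apply: (bigmin_inf (Ordinal (ltnW hM1))) => //.
    exact: (noise_le_cst hN hK1 hmodel hindep hident hfhat hBf hb1).
rewrite lee_fin [leRHS]mulrDl lerD//.
- rewrite -mulrA ler_wpM2l ?(ltW B20)//.
  exact: union_bound_le_rate.
- set L := (_ `^ _).
  have -> : M2%:R * (2 * (1 + fluct)) / ln 2 * L =
      M2%:R * (2 * ((1 + fluct) * ((ln 2)^-1 * L))) by rewrite !mulrA.
  rewrite ler_wpM2l// ler_wpM2l// ler_wpM2l ?addr_ge0//.
  exact: invsqrt_le_rate.
Qed.
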